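(* Let $\Bbbk$ be an algebraically closed field of characteristic zero, let $J$ be the bosonization of the Jordan plane over the infinite cyclic group (presented in the context), and let $\Omega=x^2g^{-1}\in Z(J)$. (1) A complete set of pairwise non-isomorphic finite-dimensional simple $J$-modules is $$\{[S_{\beta,\gamma}]\mid\beta\in\Bbbk^*,\ \gamma\in\Bbbk\},\qquad S_{\beta,\gamma}:=J/\langle x,g-\beta,y-\gamma\rangle.$$ In particular, every finite-dimensional simple $J$-module is one-dimensional. (2) A simple $J$-module $M$ is infinite-dimensional if and only if the central element $\Omega$ acts on $M$ by a nonzero scalar. Thus $$\widehat J(\text{infinite-dimensional})=\bigsqcup_{\alpha\in\Bbbk^*}\widehat{J^\alpha},\qquad J^\alpha:=J/(\Omega-\alpha)J.$$
   Context: $\Bbbk^*=\Bbbk\setminus\{0\}$. $J$ is the associative unital $\Bbbk$-algebra generated by $g^{\pm1},x,y$ with defining relations $gg^{-1}=g^{-1}g=1$, $gxg^{-1}=x$, $gyg^{-1}=y+x$, $yx-xy=-\tfrac12x^2$. Modules are left modules and dimension is over $\Bbbk$. $\langle\mathcal S\rangle$ denotes the two-sided ideal generated by $\mathcal S$. For an algebra $R$, $\widehat R$ denotes the set of isomorphism classes $[M]$ of simple $R$-modules $M$; $\widehat R(\text{infinite-dimensional})$ is the subset of classes of infinite-dimensional ones. Simple $J^\alpha$-modules are regarded as simple $J$-modules via the projection $J\to J^\alpha$. *)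

(* Defs.v *)
From HB Require Import structures.
From mathcomp Require Import all_boot all_order all_algebra.
From mathcomp Require Import generic_quotient ring_quotient.
From mathcomp Require Import finmap monalg boolp classical_sets.

Set Implicit Arguments.
Unset Strict Implicit.
Unset Printing Implicit Defensive.

Import GRing.Theory.

Local Open Scope ring_scope.
Local Open Scope classical_set_scope.
Local Open Scope quotient_scope.

(* The two-sided ideal <S>; closure under opposite and under scaling by k     *)
(* follows from multiplication by -1 and by c%:A.                             *)
Inductive ideal_gen (A : pzRingType) (S : set A) : A -> Prop :=
| ideal_gen_mem a : S a -> ideal_gen S a
| ideal_gen0 : ideal_gen S 0
| ideal_genD a b : ideal_gen S a -> ideal_gen S b -> ideal_gen S (a + b)
| ideal_genMl a b : ideal_gen S b -> ideal_gen S (a * b)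
| ideal_genMr a b : ideal_gen S a -> ideal_gen S (a * b).

Definition ideal_pred (A : pzRingType) (S : set A) : {pred A} :=
  fun a => `[< ideal_gen S a >].

Lemma ideal_predP (A : pzRingType) (S : set A) a :
  reflect (ideal_gen S a) (a \in ideal_pred S).
Proof. exact: asboolP. Qed.

Lemma ideal_pred_zmod_closed (A : pzRingType) (S : set A) :
  zmod_closed (ideal_pred S).
Proof.
split; first by apply/ideal_predP; exact: ideal_gen0.
move=> a b /ideal_predP Sa /ideal_predP Sb; apply/ideal_predP.
by apply: ideal_genD => //; rewrite -mulN1r; exact: ideal_genMl.
Qed.

HB.instance Definition _ (A : pzRingType) (S : set A) :=
  GRing.isZmodClosed.Build A (ideal_pred S) (ideal_pred_zmod_closed S).

(* The quotient A / <S>; for noncommutative A the library only provides its   *)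
(* additive group.  Multiplication and scaling are locked to keep unification *)
(* from unfolding them.                                                       *)
Definition quot_alg (A : pzRingType) (S : set A) : Type :=
  Quotient.quot (ideal_pred S).

HB.instance Definition _ (A : pzRingType) (S : set A) :=
  GRing.Zmodule.on (quot_alg S).

Definition quot_pi (A : pzRingType) (S : set A) (a : A) : quot_alg S :=
  \pi_(Quotient.quot (ideal_pred S)) a.

HB.lock Definition quot_mul (A : pzRingType) (S : set A) (u v : quot_alg S) :
    quot_alg S :=
  quot_pi S (repr (u : Quotient.quot _) * repr (v : Quotient.quot _)).
Canonical quot_mul_unlockable := Unlockable quot_mul.unlock.

Section QuotAlg.
Variables (A : pzRingType) (S : set A).
Implicit Types (a b c : A) (u v w : quot_alg S).
Local Notation pi := (quot_pi S).
Local Notation rp := (fun u : quot_alg S => repr (u : Quotient.quot _)).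

Lemma quot_piP a b : reflect (pi a = pi b) (a - b \in ideal_pred S).
Proof. by rewrite Quotient.idealrBE; exact: eqP. Qed.

Lemma quot_reprK u : pi (rp u) = u.
Proof. exact: reprK. Qed.

Lemma quot_pi_zmod_morphism : zmod_morphism pi.
Proof. by move=> a b; exact: (raddfB \pi_(Quotient.quot (ideal_pred S))). Qed.

HB.instance Definition _ :=
  GRing.isZmodMorphism.Build A (quot_alg S) pi quot_pi_zmod_morphism.

Definition quot_one : quot_alg S := pi 1.

Lemma quot_pi_mul a b : pi (a * b) = quot_mul (pi a) (pi b).
Proof.
rewrite [quot_mul]unlock; apply/quot_piP; set a' := repr _; set b' := repr _.
have -> : a * b - a' * b' = a * (b - b') + (a - a') * b'.
  by rewrite mulrBr mulrBl addrA subrK.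
apply/ideal_predP/ideal_genD.
- by apply/ideal_genMl/ideal_predP/quot_piP; rewrite quot_reprK.
- by apply/ideal_genMr/ideal_predP/quot_piP; rewrite quot_reprK.
Qed.

Lemma quot_mulA : associative (@quot_mul _ S).
Proof.
move=> u v w; rewrite -[u]quot_reprK -[v]quot_reprK -[w]quot_reprK.
by rewrite -!quot_pi_mul mulrA.
Qed.

Lemma quot_mul1 : left_id quot_one (@quot_mul _ S).
Proof. by move=> u; rewrite -[u]quot_reprK -quot_pi_mul mul1r. Qed.

Lemma quot_mulr1 : right_id quot_one (@quot_mul _ S).
Proof. by move=> u; rewrite -[u]quot_reprK -quot_pi_mul mulr1. Qed.

Lemma quot_mulDl : left_distributive (@quot_mul _ S) +%R.
Proof.
move=> u v w; rewrite -[u]quot_reprK -[v]quot_reprK -[w]quot_reprK.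
by rewrite -raddfD -!quot_pi_mul mulrDl raddfD.
Qed.

Lemma quot_mulDr : right_distributive (@quot_mul _ S) +%R.
Proof.
move=> u v w; rewrite -[u]quot_reprK -[v]quot_reprK -[w]quot_reprK.
by rewrite -raddfD -!quot_pi_mul mulrDr raddfD.
Qed.

HB.instance Definition _ := GRing.Zmodule_isPzRing.Build (quot_alg S)
  quot_mulA quot_mul1 quot_mulr1 quot_mulDl quot_mulDr.

Lemma quot_pi_monoid_morphism : monoid_morphism pi.
Proof. by split=> // a b; exact: quot_pi_mul. Qed.

HB.instance Definition _ :=
  GRing.isMonoidMorphism.Build A (quot_alg S) pi quot_pi_monoid_morphism.

Lemma quot_lift (B : pzRingType) (f : {rmorphism A -> B}) :
  (forall s, S s -> f s = 0) ->
  exists h : {rmorphism quot_alg S -> B}, forall a, h (pi a) = f a.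
Proof.
move=> fS; pose h (u : quot_alg S) := f (rp u).
have hE a : h (pi a) = f a.
  apply/eqP; rewrite -subr_eq0 -rmorphB; apply/eqP.
  have /ideal_predP : rp (pi a) - a \in ideal_pred S.
    by apply/quot_piP; rewrite quot_reprK.
  elim=> {a} [a /fS //||a b _ IHa _ IHb|a b _ IH|a b _ IH].
  - exact: rmorph0.
  - by rewrite rmorphD IHa IHb addr0.
  - by rewrite rmorphM IH mulr0.
  - by rewrite rmorphM IH mul0r.
have hB : zmod_morphism h.
  move=> u v; rewrite -[u]quot_reprK -[v]quot_reprK.
  by rewrite -raddfB !hE raddfB.
have hM : monoid_morphism h.
  split=> [|u v]; first by rewrite -[1]/(pi 1) hE rmorph1.
  by rewrite -[u]quot_reprK -[v]quot_reprK -rmorphM !hE rmorphM.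
pose aM := GRing.isZmodMorphism.Build _ _ h hB.
pose mM := GRing.isMonoidMorphism.Build _ _ h hM.
pose hh : {rmorphism quot_alg S -> B} := HB.pack h aM mM.
by exists hh.
Qed.

End QuotAlg.

HB.lock Definition quot_scale (K : pzRingType) (A : algType K) (S : set A)
  (c : K) (u : quot_alg S) : quot_alg S := quot_pi S c%:A * u.
Canonical quot_scale_unlockable := Unlockable quot_scale.unlock.

Section QuotAlgScale.
Variables (K : pzRingType) (A : algType K) (S : set A).
Local Notation pi := (quot_pi S).

Local Notation quot_scale := (@quot_scale K A S).

Lemma quot_scaleE c u : quot_scale c u = pi c%:A * u.
Proof. by rewrite unlock. Qed.

Lemma quot_scaleA c d u : quot_scale c (quot_scale d u) = quot_scale (c * d) u.
Proof. by rewrite !quot_scaleE mulrA -rmorphM /= mulr_algl scalerA. Qed.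

Lemma quot_scale1 : left_id 1 quot_scale.
Proof. by move=> u; rewrite !quot_scaleE scale1r rmorph1 mul1r. Qed.

Lemma quot_scaleDr : right_distributive quot_scale +%R.
Proof. by move=> c u v; rewrite !quot_scaleE mulrDr. Qed.

Lemma quot_scaleDl u : {morph quot_scale^~ u : c d / c + d}.
Proof. by move=> c d; rewrite !quot_scaleE scalerDl raddfD mulrDl. Qed.

HB.instance Definition _ := GRing.Zmodule_isLmodule.Build K (quot_alg S)
  quot_scaleA quot_scale1 quot_scaleDr quot_scaleDl.

Lemma quot_scaleAl c (u v : quot_alg S) : c *: (u * v) = c *: u * v.
Proof. by rewrite /GRing.scale /= !quot_scaleE mulrA. Qed.

Lemma quot_scaleAr c (u v : quot_alg S) : c *: (u * v) = u * (c *: v).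
Proof.
rewrite -[u]quot_reprK; set a := repr _.
have E : pi c%:A * pi a = pi a * pi c%:A.
  by rewrite -!rmorphM mulr_algl mulr_algr.
by rewrite /GRing.scale /= !quot_scaleE mulrA E -mulrA.
Qed.

Lemma quot_pi_scalable : scalable pi.
Proof.
move=> c a; rewrite -[c *: a]mulr_algl rmorphM.
by rewrite [RHS]/GRing.scale /= quot_scaleE.
Qed.

HB.instance Definition _ :=
  GRing.isScalable.Build K A (quot_alg S) *:%R pi quot_pi_scalable.

End QuotAlgScale.

(* The free associative k-algebra on I is {malg k[{fmonom I}]}.  It is        *)
(* renamed because the library declares {malg k[M]} an algType only for       *)
(* commutative M; the operations are locked to keep unification from          *)
(* unfolding them.                                                            *)

Definition free_alg (I : choiceType) (k : comNzRingType) : Type :=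
  {malg k[{fmonom I}]}.

HB.lock Definition free_add (I : choiceType) (k : comNzRingType)
  (u v : {malg k[{fmonom I}]}) : {malg k[{fmonom I}]} := u + v.
HB.lock Definition free_opp (I : choiceType) (k : comNzRingType)
  (u : {malg k[{fmonom I}]}) : {malg k[{fmonom I}]} := - u.
HB.lock Definition free_mul (I : choiceType) (k : comNzRingType)
  (u v : {malg k[{fmonom I}]}) : {malg k[{fmonom I}]} := u * v.
HB.lock Definition free_scale (I : choiceType) (k : comNzRingType)
  (c : k) (u : {malg k[{fmonom I}]}) : {malg k[{fmonom I}]} := c *: u.
HB.lock Definition free_gen (I : choiceType) (k : comNzRingType)
  (i : I) : free_alg I k := mkmalgU (fmu i) 1.

Section FreeAlg.
Variables (I : choiceType) (k : comNzRingType).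
Local Notation malgI := {malg k[{fmonom I}]}.
Implicit Types (c d : k) (u v w : malgI).

Lemma free_addE u v : free_add u v = u + v.
Proof. by rewrite free_add.unlock. Qed.
Lemma free_oppE u : free_opp u = - u.
Proof. by rewrite free_opp.unlock. Qed.
Lemma free_mulE u v : free_mul u v = u * v.
Proof. by rewrite free_mul.unlock. Qed.
Lemma free_scaleE c u : free_scale c u = c *: u.
Proof. by rewrite free_scale.unlock. Qed.

Lemma free_genE i : free_gen k i = mkmalgU (fmu i) 1 :> malgI.
Proof. by rewrite free_gen.unlock. Qed.

Lemma free_addA : associative (@free_add I k).
Proof. by move=> u v w; rewrite !free_addE addrA. Qed.
Lemma free_addC : commutative (@free_add I k).
Proof. by move=> u v; rewrite !free_addE addrC. Qed.
Lemma free_add0 : left_id (0 : malgI) (@free_add I k).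
Proof. by move=> u; rewrite free_addE add0r. Qed.
Lemma free_addN : left_inverse (0 : malgI) (@free_opp I k) (@free_add I k).
Proof. by move=> u; rewrite free_addE free_oppE addNr. Qed.
Lemma free_mulA : associative (@free_mul I k).
Proof. by move=> u v w; rewrite !free_mulE mulrA. Qed.
Lemma free_mul1 : left_id (1 : malgI) (@free_mul I k).
Proof. by move=> u; rewrite free_mulE mul1r. Qed.
Lemma free_mulr1 : right_id (1 : malgI) (@free_mul I k).
Proof. by move=> u; rewrite free_mulE mulr1. Qed.
Lemma free_mulDl : left_distributive (@free_mul I k) (@free_add I k).
Proof. by move=> u v w; rewrite !free_mulE !free_addE mulrDl. Qed.
Lemma free_mulDr : right_distributive (@free_mul I k) (@free_add I k).
Proof. by move=> u v w; rewrite !free_mulE !free_addE mulrDr. Qed.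
Lemma free_scaleA c d u : free_scale c (free_scale d u) = free_scale (c * d) u.
Proof. by rewrite !free_scaleE scalerA. Qed.
Lemma free_scale1 : left_id 1 (@free_scale I k).
Proof. by move=> u; rewrite free_scaleE scale1r. Qed.
Lemma free_scaleDr : right_distributive (@free_scale I k) (@free_add I k).
Proof. by move=> c u v; rewrite !free_scaleE !free_addE scalerDr. Qed.
Lemma free_scaleDl u c d :
  free_scale (c + d) u = free_add (free_scale c u) (free_scale d u).
Proof. by rewrite !free_scaleE free_addE scalerDl. Qed.
Lemma free_scaleAl c u v :
  free_scale c (free_mul u v) = free_mul (free_scale c u) v.
Proof. by rewrite !free_scaleE !free_mulE scalerAl. Qed.
Lemma free_scaleAr c u v :
  free_scale c (free_mul u v) = free_mul u (free_scale c v).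
Proof.
rewrite !free_scaleE !free_mulE; apply/malgP => m.
rewrite (mcoeffZ c (u * v) m) [in LHS]mcoeffMl.
rewrite (mcoeffMlw m (fsubset_refl (msupp u)) (msuppZ_le c v)).
rewrite big_distrr; apply: eq_bigr => i _.
rewrite big_distrr; apply: eq_bigr => j _.
by rewrite (mcoeffZ c v j) mulrCA [LHS]mulrnAr.
Qed.

HB.instance Definition _ := Choice.copy (free_alg I k) malgI.
HB.instance Definition _ := GRing.isZmodule.Build (free_alg I k)
  free_addA free_addC free_add0 free_addN.
HB.instance Definition _ := GRing.Zmodule_isNzRing.Build (free_alg I k)
  free_mulA free_mul1 free_mulr1 free_mulDl free_mulDr (oner_neq0 malgI).
HB.instance Definition _ := GRing.Zmodule_isLmodule.Build k (free_alg I k)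
  free_scaleA free_scale1 free_scaleDr free_scaleDl.
HB.instance Definition _ := GRing.Lmodule_isLalgebra.Build k (free_alg I k)
  free_scaleAl.
HB.instance Definition _ := GRing.Lalgebra_isAlgebra.Build k (free_alg I k)
  free_scaleAr.

Lemma free_alg_ind (P : free_alg I k -> Prop) :
  (forall c, P c%:A) -> (forall i, P (free_gen k i)) ->
  (forall u v : free_alg I k, P u -> P v -> P (u + v)) ->
  (forall u v : free_alg I k, P u -> P v -> P (u * v)) -> forall u : free_alg I k, P u.
Proof.
move=> Pc Pg PD PM u.
have P0 : P (0 : free_alg I k) by rewrite -(scale0r 1); exact: Pc.
have P1 : P (1 : free_alg I k) by rewrite -(scale1r 1); exact: Pc.
have Pm (s : seq I) : P (mkmalgU (FMonom s) 1).
  elim: s => [|i s IH]; first by rewrite -fmoneE; exact: P1.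
  suff -> : mkmalgU (FMonom (i :: s)) (1 : k) =
      free_mul (mkmalgU (fmu i) 1) (mkmalgU (FMonom s) 1).
    rewrite -free_genE; exact: (PM _ _ (Pg i) IH).
  apply/esym; rewrite free_mulE malgM_def.
  apply: etrans (fgmulUU _ _ _ _) _.
  by rewrite mulr1 fmuE; congr mkmalgU; exact: fmmulE.
have Pcm c (m : {fmonom I}) : P (mkmalgU m c).
  suff -> : mkmalgU m c = free_mul (free_scale c 1) (mkmalgU m 1).
    by apply: PM; [exact: Pc|case: m => s; exact: Pm].
  rewrite free_scaleE free_mulE mulr_algl; apply/malgP => n.
  by rewrite mcoeffZ !mcoeffU mulrnAr mulr1.
rewrite [u]monalgE; move: (msupp u : seq _) => s.
elim: s => [|m s IH]; first by rewrite big_nil; exact: P0.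
by rewrite big_cons -free_addE; apply: PD.
Qed.

Lemma free_lift (B : algType k) (h : I -> B) :
  exists f : {lrmorphism free_alg I k -> B}, forall i, f (free_gen k i) = h i.
Proof.
pose hm (m : {fmonom I}) : B := \prod_(i <- (m : seq I)) h i.
have hm_morph : mmorphism hm.
  by split=> [m n|]; rewrite /hm ?fmM ?big_cat // fm1 big_nil.
pose hM : {mmorphism {fmonom I} -> B} :=
  HB.pack hm (isMultiplicative.Build _ _ hm hm_morph).
pose f : free_alg I k -> B := mmap (in_alg B) hM.
have fB : zmod_morphism f.
  move=> u v; rewrite -[u - v]/(free_add u (free_opp v)) free_addE free_oppE.
  exact: raddfB.
have fM : monoid_morphism f.
  have [] := @commr_mmap_is_multiplicative _ _ _ (in_alg B) hM.
    by move=> u m m'; rewrite /GRing.comm mulr_algl mulr_algr.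
  move=> fM f1; split=> [|u v]; first exact: f1.
  rewrite -[u * v]/(free_mul u v) free_mulE; exact: fM.
have fZ : scalable f.
  move=> c u; rewrite -[RHS]mulr_algl -[c *: u]/(free_scale c u) free_scaleE.
  exact: (mmapZ c u).
pose ff : {lrmorphism free_alg I k -> B} := HB.pack f
  (GRing.isZmodMorphism.Build _ _ f fB)
  (GRing.isMonoidMorphism.Build _ _ f fM)
  (GRing.isScalable.Build _ _ _ _ f fZ).
exists ff => i; rewrite -[ff _]/(f _) /f free_genE.
by rewrite mmapU /= scale1r mul1r /hm fmU big_seq1.
Qed.

End FreeAlg.

Variant jgen := JG | JGinv | JX | JY.

Definition jgen_code (i : jgen) : nat :=
  match i with JG => 0 | JGinv => 1 | JX => 2 | JY => 3 end.
Definition jgen_decode (n : nat) : jgen :=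
  match n with 0 => JG | 1 => JGinv | 2 => JX | _ => JY end.
Lemma jgen_codeK : cancel jgen_code jgen_decode. Proof. by case. Qed.
HB.instance Definition _ := Choice.copy jgen (can_type jgen_codeK).

Section Jordan.
Variable k : fieldType.

Local Notation g := (free_gen k JG).
Local Notation g' := (free_gen k JGinv).
Local Notation x := (free_gen k JX).
Local Notation y := (free_gen k JY).

(* The constructors are the defining relations, in the form lhs - rhs. *)
Variant jordan_rel : set (free_alg jgen k) :=
| jordan_gg' : jordan_rel (g * g' - 1)
| jordan_g'g : jordan_rel (g' * g - 1)
| jordan_gx : jordan_rel (g * x * g' - x)
| jordan_gy : jordan_rel (g * y * g' - (y + x))
| jordan_yx : jordan_rel ((y * x - x * y) - (- (2^-1 *: x ^+ 2))).

Definition jordan : Type := quot_alg jordan_rel.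

HB.instance Definition _ := GRing.PzRing.on jordan.
HB.instance Definition _ := GRing.Lmodule.copy jordan (quot_alg jordan_rel).

Lemma jordan_rel_morph (B : algType k) (f : {lrmorphism free_alg jgen k -> B})
    (h : jgen -> B) (fE : forall i, f (free_gen k i) = h i) :
  [/\ h JG * h JGinv = 1, h JGinv * h JG = 1,
      h JG * h JX * h JGinv = h JX, h JG * h JY * h JGinv = h JY + h JX &
      h JY * h JX - h JX * h JY = - (2^-1 *: h JX ^+ 2)] <->
  (forall r, jordan_rel r -> f r = 0).
Proof.
have fB u v : f (u - v) = f u - f v by exact: rmorphB.
have fD u v : f (u + v) = f u + f v by exact: rmorphD.
have fN u : f (- u) = - f u by exact: rmorphN.
have fM u v : f (u * v) = f u * f v by exact: rmorphM.
have fX u : f (u ^+ 2) = f u ^+ 2 by exact: rmorphXn.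
have fZ c u : f (c *: u) = c *: f u by exact: linearZ.
have f1 : f 1 = 1 by exact: rmorph1.
have e1 : f (g * g' - 1) = h JG * h JGinv - 1 by rewrite fB fM f1 !fE.
have e2 : f (g' * g - 1) = h JGinv * h JG - 1 by rewrite fB fM f1 !fE.
have e3 : f (g * x * g' - x) = h JG * h JX * h JGinv - h JX.
  by rewrite fB fM fM !fE.
have e4 : f (g * y * g' - (y + x)) = h JG * h JY * h JGinv - (h JY + h JX).
  by rewrite fB fM fM fD !fE.
have e5 : f (y * x - x * y - (- (2^-1 *: x ^+ 2))) =
    h JY * h JX - h JX * h JY - (- (2^-1 *: h JX ^+ 2)).
  by rewrite fB fB fM fM fN fZ fX !fE.
have sub0 (u v : B) : u - v = 0 <-> u = v.
  by split=> [/eqP|->]; rewrite ?subrr // subr_eq0 => /eqP.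
split.
  case=> /sub0 r1 /sub0 r2 /sub0 r3 /sub0 r4 /sub0 r5 r.
  by case; rewrite ?e1 ?e2 ?e3 ?e4 ?e5.
move=> H; split; apply/sub0.
- by rewrite -e1; apply: H; constructor.
- by rewrite -e2; apply: H; constructor.
- by rewrite -e3; apply: H; constructor.
- by rewrite -e4; apply: H; constructor.
- by rewrite -e5; apply: H; constructor.
Qed.

(* J is not the zero ring: g |-> 1, x, y |-> 0 defines a morphism J -> k. *)
Lemma jordan_oner_neq0 : 1 != 0 :> jordan.
Proof.
pose h (i : jgen) : k^o := match i with JG | JGinv => 1 | _ => 0 end.
have [f fE] := free_lift h.
have [|e eE] := quot_lift (S := jordan_rel) (f := f).
  apply/(jordan_rel_morph fE); rewrite /h.
  by rewrite !mulr0 !mul0r mulr1 addr0 subrr expr0n scaler0 oppr0.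
apply/eqP => one0; have /eqP := rmorph1 e; rewrite [X in e X]one0 rmorph0.
by rewrite eq_sym oner_eq0.
Qed.

HB.instance Definition _ :=
  GRing.PzSemiRing_isNonZero.Build jordan jordan_oner_neq0.
HB.instance Definition _ := GRing.Lmodule_isLalgebra.Build k jordan
  (@quot_scaleAl _ _ jordan_rel).
HB.instance Definition _ := GRing.Lalgebra_isAlgebra.Build k jordan
  (@quot_scaleAr _ _ jordan_rel).

Definition jordan_pi : free_alg jgen k -> jordan := quot_pi jordan_rel.
HB.instance Definition _ := GRing.LRMorphism.copy jordan_pi (quot_pi jordan_rel).

Definition J_g : jordan := jordan_pi (free_gen k JG).
Definition J_ginv : jordan := jordan_pi (free_gen k JGinv).
Definition J_x : jordan := jordan_pi (free_gen k JX).
Definition J_y : jordan := jordan_pi (free_gen k JY).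
Definition Omega : jordan := J_x ^+ 2 * J_ginv.

Lemma J_relations :
  [/\ J_g * J_ginv = 1, J_ginv * J_g = 1, J_g * J_x * J_ginv = J_x,
      J_g * J_y * J_ginv = J_y + J_x &
      J_y * J_x - J_x * J_y = - (2^-1 *: J_x ^+ 2)].
Proof.
have := @jordan_rel_morph jordan jordan_pi
  (fun i => jordan_pi (free_gen k i)) (fun=> erefl).
case=> _; apply=> r rr; rewrite -(raddf0 jordan_pi).
by apply/quot_piP; rewrite subr0; apply/ideal_predP/ideal_gen_mem.
Qed.

Lemma jordan_lift (B : algType k) (b b' u v : B) :
  b * b' = 1 -> b' * b = 1 -> b * u * b' = u -> b * v * b' = v + u ->
  v * u - u * v = - (2^-1 *: u ^+ 2) ->
  exists f : {lrmorphism jordan -> B},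
    [/\ f J_g = b, f J_ginv = b', f J_x = u & f J_y = v].
Proof.
move=> r1 r2 r3 r4 r5.
pose h i := match i with JG => b | JGinv => b' | JX => u | JY => v end.
have [f fE] := free_lift h.
have [|e eE] := quot_lift (S := jordan_rel) (f := f).
  by apply/(jordan_rel_morph fE); split.
have eZ : scalable (e : jordan -> B).
  move=> c w; rewrite -[w]quot_reprK; set a := repr _.
  have <- : jordan_pi (c *: a) = c *: jordan_pi a by exact: linearZ.
  rewrite /jordan_pi !eE; exact: linearZ.
pose ee : {lrmorphism jordan -> B} := HB.pack (e : jordan -> B)
  (GRing.RMorphism.class e) (GRing.isScalable.Build _ _ _ _ (e : jordan -> B) eZ).
by exists ee; split; [exact: etrans (eE _) (fE JG)|
  exact: etrans (eE _) (fE JGinv)|exact: etrans (eE _) (fE JX)|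
  exact: etrans (eE _) (fE JY)].
Qed.

Lemma jordan_ind (P : jordan -> Prop) :
  (forall c, P c%:A) -> P J_g -> P J_ginv -> P J_x -> P J_y ->
  (forall u v, P u -> P v -> P (u + v)) ->
  (forall u v, P u -> P v -> P (u * v)) -> forall u, P u.
Proof.
move=> Pc Pg Pg' Px Py PD PM u; rewrite -[u]quot_reprK -/jordan_pi.
elim/free_alg_ind: (repr _) => [c|[]|a b Pa Pb|a b Pa Pb] //.
- by rewrite linearZ rmorph1; exact: Pc.
- by rewrite raddfD; exact: PD.
- by rewrite rmorphM; exact: PM.
Qed.

Lemma Omega_central (a : jordan) : 2 != 0 :> k -> a * Omega = Omega * a.
Proof.
move=> two_neq0; have [gg' g'g gx gy yx] := J_relations.
have gxC : J_g * J_x = J_x * J_g by rewrite -{2}gx -mulrA g'g mulr1.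
have g'xC : J_ginv * J_x = J_x * J_ginv.
  by rewrite -[LHS]mulr1 -gg' mulrA -[_ * J_x * _]mulrA -gxC mulrA g'g mul1r.
have g'y : J_ginv * J_y = (J_y - J_x) * J_ginv.
  have := congr1 ( *%R J_ginv) gy; rewrite !mulrA g'g mul1r mulrDr g'xC.
  by rewrite mulrBl => ->; rewrite addrK.
have yxx : J_y * J_x ^+ 2 = J_x ^+ 2 * (J_y - J_x).
  have yxE : J_y * J_x = J_x * J_y - 2^-1 *: J_x ^+ 2.
    by rewrite -yx addrC subrK.
  rewrite expr2 mulrA yxE mulrBl -[J_x * J_y * J_x]mulrA yxE !mulrBr !mulrA.
  rewrite -scalerAl -scalerAr expr2 !mulrA -addrA -opprD -scalerDl.
  have -> : 2^-1 + 2^-1 = 1 :> k by rewrite -mulr2n -[LHS]mulr_natl divff.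
  by rewrite scale1r.
rewrite /Omega; elim/jordan_ind: a => [c|||||u v Hu Hv|u v Hu Hv].
- by rewrite mulr_algl mulr_algr.
- by rewrite mulrA expr2 mulrA gxC -[_ * J_g * J_x]mulrA gxC -!mulrA gg' g'g.
- by rewrite mulrA expr2 mulrA g'xC -[_ * _ * J_x]mulrA g'xC !mulrA.
- by rewrite expr2 -!mulrA g'xC.
- by rewrite mulrA yxx -!mulrA g'y.
- by rewrite mulrDl mulrDr Hu Hv.
- by rewrite -mulrA Hv mulrA Hu mulrA.
Qed.

End Jordan.

Definition restrict (A B : pzRingType) (f : {rmorphism A -> B})
  (M : lmodType B) : Type := M.

Section Restrict.
Variables (A B : pzRingType) (f : {rmorphism A -> B}) (M : lmodType B).

HB.instance Definition _ := GRing.Zmodule.on (restrict f M).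

Definition restrict_scale (a : A) (m : restrict f M) : restrict f M :=
  f a *: (m : M).

Lemma restrict_scaleA a b m :
  restrict_scale a (restrict_scale b m) = restrict_scale (a * b) m.
Proof. by rewrite /restrict_scale scalerA rmorphM. Qed.

Lemma restrict_scale1 : left_id 1 restrict_scale.
Proof. by move=> m; rewrite /restrict_scale rmorph1 scale1r. Qed.

Lemma restrict_scaleDr : right_distributive restrict_scale +%R.
Proof. by move=> a m n; exact: scalerDr. Qed.

Lemma restrict_scaleDl m : {morph restrict_scale^~ m : a b / a + b}.
Proof. by move=> a b; rewrite /restrict_scale rmorphD; exact: scalerDl. Qed.

HB.instance Definition _ := GRing.Zmodule_isLmodule.Build A (restrict f M)
  restrict_scaleA restrict_scale1 restrict_scaleDr restrict_scaleDl.

End Restrict.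

Definition simple_mod (R : pzRingType) (M : lmodType R) : Prop :=
  (exists m : M, m != 0) /\
  forall N : {pred M}, submod_closed N -> N =i pred1 0 \/ N =i predT.

Definition iso_mod (R : pzRingType) (M N : lmodType R) : Prop :=
  exists f : {linear M -> N}, bijective f.

(* Isomorphism classes and sets of them are bare predicates, because          *)
(* [set (lmodType R)] is ruled out by the library's universe constraints.     *)

Definition mod_class (R : pzRingType) : Type := lmodType R -> Prop.

Definition iso_class (R : pzRingType) (M : lmodType R) : mod_class R :=
  fun N => iso_mod M N.

Definition hat (R : pzRingType) : mod_class R -> Prop :=
  fun C => exists M, simple_mod M /\ C = iso_class M.

Section Dimension.
Variables (k : fieldType) (A : algType k).

Definition has_dim (M : lmodType A) (n : nat) : Prop :=
  iso_mod (restrict (in_alg A) M) 'rV[k]_n.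

Definition fin_dim (M : lmodType A) : Prop := exists n, has_dim M n.

Definition hat_fin : mod_class A -> Prop :=
  fun C => exists M, [/\ simple_mod M, fin_dim M & C = iso_class M].

Definition hat_inf : mod_class A -> Prop :=
  fun C => exists M, [/\ simple_mod M, ~ fin_dim M & C = iso_class M].

End Dimension.

(* The class over A of the restrictions along f of the members of C. *)
Definition restrict_class (A B : pzRingType) (f : {rmorphism A -> B})
  (C : mod_class B) : mod_class A :=
  fun N => exists2 M, C M & iso_mod (restrict f M) N.

Section JordanModules.
Variable k : fieldType.
Implicit Types alpha beta gamma : k.

Definition S_rel beta gamma : set (jordan k) :=
  [set J_x k; J_g k - beta%:A; J_y k - gamma%:A].

(* J / <x, g - beta, y - gamma> as a left J-module. *)
Definition S_mod beta gamma : lmodType (jordan k) :=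
  restrict (quot_pi (S_rel beta gamma)) (quot_alg (S_rel beta gamma))^o.

(* (Omega - alpha) J is already a two-sided ideal, as Omega is central. *)
Definition Jalpha_rel alpha : set (jordan k) :=
  [set (Omega k - alpha%:A) * a | a in [set: jordan k]].

Definition Jalpha alpha : pzRingType := quot_alg (Jalpha_rel alpha).

Definition Jalpha_pi alpha : {rmorphism jordan k -> Jalpha alpha} :=
  quot_pi (Jalpha_rel alpha).

End JordanModules.

(* Main.v *)
From HB Require Import structures.
From mathcomp Require Import all_boot all_order all_algebra.
From mathcomp Require Import boolp classical_sets.
Require Import Defs.

Import GRing.Theory.
Local Open Scope ring_scope.

Set Implicit Arguments.
Unset Strict Implicit.
Unset Printing Implicit Defensive.

(** Let M be a simple J-module.  The relations give x J = J x, so the kernel of x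
is a submodule and x acts on M either by zero or injectively.

If x acts by zero, M is a simple module over the commutative algebra
k[g^-1, g, y], so by the Nullstellensatz g and y act by scalars beta <> 0 and
gamma ([x_zero_scalars]); M is then a line and is isomorphic to S_(beta, gamma).

If x acts injectively, so does Omega, because Omega g = x^2.  Once Omega is known
to act by a scalar alpha, M is infinite-dimensional: on a space of finite
dimension n > 0 the matrix X of x would be invertible and the relation between y
and x would read Y X^-1 - X^-1 Y = - 1/2, whose trace 0 = - n / 2 is impossible
in characteristic zero ([Omega_nonzero_infinite]).  The two cases therefore
separate the finite-dimensional simple modules from the infinite-dimensional
ones, and Omega = 0 from Omega = alpha <> 0.

The substance is that a central operator z is a scalar ([Omega_scalar], and also
the Nullstellensatz above).  The field k may be countable, so counting dimensions
does not help; the argument is Quillen's, by generic freeness.  If z is not a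
scalar then every z - c is bijective.  Suppose that M is, up to inverting a
single s, contained in a free module having m in its basis, over a domain R that
contains k[z].  Then m / (z - c) can only exist if z - c divides a
power of s, which fails for all but finitely many c ([generic_freeness]).
For commuting operators z, y one takes R = k[z] and the powers of y.  For
z = Omega and x injective one would like R = k[Omega][x] and the powers of y,
where y acts on R as a derivation; this works as soon as some vector has zero
annihilator in R ([exists_torsion]).  Otherwise choose p in R and m <> 0 with
p m = 0 and p of least degree in x.  As in the theory of D-modules supported on
a hypersurface (Kashiwara), the powers of y are independent over the kernel of p
([y_independent]), which forces m / (z - c) back into k[Omega, x] localized, m
being killed by p; there generic freeness applies over k[Omega], with x in the
place of y ([torsion_generation]).

Finally, J^alpha-modules are the J-modules on which Omega acts by alpha, and
restriction along the surjection J -> J^alpha preserves and reflects simplicity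
and isomorphism. *)

(** * Submodules and isomorphisms *)

Section Modules.
Variable R : pzRingType.
Implicit Types M N P : lmodType R.

(** Submodules as Prop-valued predicates, with closure under sums and under scaling
stated apart, the form in which closure is checked on generators below. *)
Record submodule M (N : M -> Prop) : Prop := Submodule {
  submodule0 : N 0;
  submoduleD : forall u v, N u -> N v -> N (u + v);
  submoduleZ : forall a u, N u -> N (a *: u) }.

Lemma submoduleN M (N : M -> Prop) u : submodule N -> N u -> N (- u).
Proof. by move=> [_ _ NZ] Nu; rewrite -scaleN1r; exact: NZ. Qed.

Lemma submodule_sum M (N : M -> Prop) n (F : 'I_n -> M) :
  submodule N -> (forall i, N (F i)) -> N (\sum_i F i).
Proof.
by move=> [N0 ND _] NF; elim/big_ind: _ => // i _; exact: NF.
Qed.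

(** How simplicity is used throughout: a property that is closed under the module
operations and holds at one nonzero vector holds everywhere. *)
Lemma simple_submodule_full M (N : M -> Prop) m u :
  simple_mod M -> submodule N -> N m -> m != 0 -> N u.
Proof.
move=> [_ sM] [N0 ND NZ] Nm m0.
case: (sM (fun v => `[< N v >])).
- split=> [|a v w /asboolP Nv /asboolP Nw]; first exact/asboolP.
  by apply/asboolP/ND => //; exact: NZ.
- move/(_ m); rewrite !unfold_in /= (negPf m0).
  by move=> H; move/asboolP: Nm; rewrite H.
- by move/(_ u); rewrite !unfold_in /= => H; apply/asboolP; rewrite H.
Qed.

Lemma simple_of_full M :
  (exists m : M, m != 0) ->
  (forall (N : M -> Prop) m u, submodule N -> N m -> m != 0 -> N u) ->
  simple_mod M.
Proof.
move=> nz full; split=> // N [N0 NL].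
have NS : submodule (fun u => u \in N).
  split=> // [u v Nu Nv|a u Nu]; first by rewrite -[u]scale1r; exact: NL.
  by rewrite -[a *: u]addr0; exact: NL.
case: (pselect (exists2 m, m \in N & m != 0)) => [[m Nm m0]|noN].
  by right=> u; rewrite (full _ _ u NS Nm m0).
left=> u; rewrite !inE; apply/idP/eqP => [Nu|-> //].
by apply/eqP/negPn/negP => u0; apply: noN; exists u.
Qed.

Lemma iso_mod_build M N (f : M -> N) :
  linear f -> (forall u, f u = 0 -> u = 0) -> (forall v, exists u, f u = v) ->
  iso_mod M N.
Proof.
move=> fL f0 fS.
pose ff : {linear M -> N} := HB.pack f (GRing.isLinear.Build R M N _ f fL).
have [g gK] := choice fS.
exists ff; exists g => [u|v]; last exact: gK.
apply/eqP; rewrite -subr_eq0; apply/eqP/f0.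
by apply: etrans (raddfB ff _ _) _; apply/eqP; rewrite subr_eq0; apply/eqP/gK.
Qed.

Lemma iso_mod_refl M : iso_mod M M.
Proof. by exists (idfun : {linear M -> M}); exists id. Qed.

Lemma iso_mod_sym M N : iso_mod M N -> iso_mod N M.
Proof.
move=> [f [g fK gK]]; apply: (@iso_mod_build N M g) => [a u v|u gu0|v].
- by apply: (can_inj fK); rewrite linearP !gK.
- by rewrite -[u]gK gu0 linear0.
- by exists (f v).
Qed.

Lemma iso_mod_trans M N P : iso_mod M N -> iso_mod N P -> iso_mod M P.
Proof.
move=> [f fB] [h hB]; exists (h \o f : {linear M -> P}); exact: bij_comp.
Qed.

Lemma iso_class_eq M N : iso_class M = iso_class N <-> iso_mod M N.
Proof.
split=> [/(congr1 (@^~ N)) E|MN].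
  by rewrite /iso_class in E; rewrite E; exact: iso_mod_refl.
apply/funext => P; apply/propext; split; last exact: iso_mod_trans.
by apply: iso_mod_trans; exact: iso_mod_sym.
Qed.

Lemma simple_iso M N : iso_mod M N -> simple_mod M -> simple_mod N.
Proof.
move=> [f [g fK gK]] sM; apply: simple_of_full.
  have [[m m0] _] := sM; exists (f m).
  by apply: contraNneq m0 => fm; apply/eqP/(can_inj fK); rewrite fm raddf0.
move=> P m u [P0 PD PZ] Pm m0; rewrite -[u]gK.
apply: (@simple_submodule_full M (fun v => P (f v)) (g m)) => //.
- split=> [|v w Pv Pw|a v Pv]; first by rewrite raddf0.
  + by rewrite raddfD; exact: PD.
  + by rewrite linearZ; exact: PZ.
- by rewrite gK.
- by apply: contraNneq m0 => gm; rewrite -[m]gK gm raddf0.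
Qed.

End Modules.

(** * Generic freeness *)

Section Freeness.
Variables (R : idomainType) (M : lmodType R) (Y : {additive M -> M}).
Variable delta : R -> R.
Hypothesis deltaM : forall a b, delta (a * b) = delta a * b + a * delta b.
Hypothesis YZ : forall r u, Y (r *: u) = r *: Y u + delta r *: u.

Lemma delta_exp s n : delta (s ^+ n.+1) = s ^+ n * (delta s *+ n.+1).
Proof.
elim: n => [|n IH]; first by rewrite expr1 expr0 mul1r.
by rewrite exprS deltaM IH mulrA -exprS [delta s * _]mulrC -mulrDr -mulrS.
Qed.

Definition Yspan (m : M) n (u : M) : Prop :=
  exists c : nat -> R, u = \sum_(j < n) c j *: iter j Y m.

Lemma Yspan_submodule m n : submodule (Yspan m n).
Proof.
split=> [|u v [c ->] [d ->]|a u [c ->]].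
- by exists (fun=> 0); rewrite big1 // => j _; rewrite scale0r.
- exists (fun j => c j + d j); rewrite -big_split.
  by apply: eq_bigr => j _; rewrite scalerDl.
- exists (fun j => a * c j); rewrite scaler_sumr.
  by apply: eq_bigr => j _; rewrite scalerA.
Qed.

Lemma Yspan_iter m n j : (j < n)%N -> Yspan m n (iter j Y m).
Proof.
move=> jn; exists (fun i => (i == j)%:R).
rewrite (bigD1 (Ordinal jn)) //= eqxx scale1r big1 ?addr0 // => i.
by rewrite -val_eqE /= => /negPf ->; rewrite scale0r.
Qed.

Lemma Yspan_le m n n' u : (n <= n')%N -> Yspan m n u -> Yspan m n' u.
Proof.
move=> nn' [c ->]; apply: submodule_sum; first exact: Yspan_submodule.
move=> i; apply: (submoduleZ (Yspan_submodule m n')).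
by apply: Yspan_iter; apply: leq_trans nn'.
Qed.

Lemma Yspan_Y m n u : Yspan m n u -> Yspan m n.+1 (Y u).
Proof.
move=> [c ->]; rewrite raddf_sum; apply: submodule_sum.
  exact: Yspan_submodule.
move=> i; have S := Yspan_submodule m n.+1; rewrite YZ; apply: submoduleD => //.
  by apply: submoduleZ => //; rewrite -iterS; apply: Yspan_iter; rewrite ltnS.
by apply: submoduleZ => //; apply: Yspan_iter; rewrite ltnS ltnW.
Qed.

Definition Yindep (m : M) n : Prop := forall c : nat -> R,
  \sum_(j < n) c j *: iter j Y m = 0 -> forall j, (j < n)%N -> c j = 0.

(** Here m is the basis vector of index 0, so q u = r m is compared at that
coordinate. *)
Lemma Yindep_divides m n q u r : (0 < n)%N -> Yindep m n ->
  Yspan m n u -> q *: u = r *: m -> exists r', r = q * r'.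
Proof.
case: n => // n _ ind [c ->] E; exists (c 0%N); apply/esym/eqP.
rewrite -subr_eq0; apply/eqP.
apply: (ind (fun j => q * c j - (if j == 0%N then r else 0))) => //.
under eq_bigr do rewrite scalerBl -scalerA.
rewrite sumrB -scaler_sumr E big_ord_recl /= big1 ?addr0 ?subrr // => i _.
by rewrite scale0r.
Qed.

(** If the vectors Y^j m are all R-independent, F is their span and s = 1.  Otherwise
let n be least with a relation s Y^n m in the span of the earlier ones; that span
is F, and since s carries Y^n m back into it, s Y preserves it. *)
Lemma free_sublattice m : (forall r, r *: m = 0 -> r = 0) ->
  exists (s : R) (F : M -> Prop), [/\ s != 0, submodule F, F m,
    (forall u, F u -> F (s *: Y u)) &
    (forall q u r, F u -> q *: u = r *: m -> exists r', r = q * r')].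
Proof.
move=> m_free.
have ind1 : Yindep m 1.
  by move=> c; rewrite big_ord1 => /m_free c0 [|j].
have [[n nind]|] := pselect (exists n, ~ Yindep m n); last first.
  move=> /forallNP/(_ _)/contrapT ind.
  exists 1, (fun u => exists n, Yspan m n u); split; first exact: oner_neq0.
  - split; first by exists 0%N; apply: submodule0; exact: Yspan_submodule.
    + move=> u v [n Fu] [n' Fv]; exists (maxn n n').
      apply: (submoduleD (Yspan_submodule _ _)).
        by apply: Yspan_le Fu; rewrite leq_maxl.
      by apply: Yspan_le Fv; rewrite leq_maxr.
    + by move=> a u [n Fu]; exists n; apply: submoduleZ => //;
        exact: Yspan_submodule.
  - by exists 1%N; exact: (Yspan_iter m (j := 0)).
  - by move=> u [n /Yspan_Y Fu]; exists n.+1; rewrite scale1r.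
  - move=> q u r [n /(Yspan_le (leqnSn n)) Fu].
    exact: (Yindep_divides _ (ind n.+1) Fu).
have exn : exists n, `[< ~ Yindep m n >] by exists n; apply/asboolP.
case: (ex_minnP exn) => {nind exn}n0 /asboolP nind minn.
case: n0 nind minn => [|n0] nind minn; first by case: nind => c _ j.
have ind : Yindep m n0.
  by apply: contrapT => H; have := minn n0 (asboolT H); rewrite ltnn.
have n0_gt0 : (0 < n0)%N by case: n0 nind {minn ind} => // /(_ ind1).
have [c [E [j [jn cj0]]]] : exists c : nat -> R,
    \sum_(j < n0.+1) c j *: iter j Y m = 0 /\ exists j, (j < n0.+1)%N /\ c j != 0.
  apply: contrapT => H; apply: nind => c E j jn; apply/eqP/negPn/negP => cj.
  by apply: H; exists c; split=> //; exists j.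
have F0 := Yspan_submodule m n0.
have top : Yspan m n0 (c n0 *: iter n0 Y m).
  move: E; rewrite big_ord_recr /= => /eqP; rewrite addrC addr_eq0 => /eqP ->.
  by apply: submoduleN F0 _; exists c.
have cn0 : c n0 != 0.
  apply: contraNneq cj0 => cn0; move: E; rewrite big_ord_recr /= cn0 scale0r addr0.
  move=> /ind H; move: jn; rewrite ltnS leq_eqVlt => /orP[/eqP ->|/H ->//].
  by rewrite cn0.
exists (c n0), (Yspan m n0); split=> //.
- exact: (Yspan_iter m (j := 0) n0_gt0).
- move=> u [d ->]; rewrite raddf_sum scaler_sumr; apply: submodule_sum => // i.
  rewrite YZ scalerDr; apply: submoduleD => //; last first.
    by do 2!apply: submoduleZ => //; exact: Yspan_iter.
  rewrite scalerA mulrC -scalerA; apply: submoduleZ => //.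
  rewrite -iterS; have [lt|] := ltnP i.+1 n0; last first.
    move=> le; have -> : i.+1 = n0 by apply/eqP; rewrite eqn_leq le ltn_ord.
    exact: top.
  by apply: submoduleZ => //; exact: Yspan_iter.
- by move=> q u r; exact: Yindep_divides.
Qed.

(** The vectors that some power of s h sends into the lattice F form a submodule which
is stable under Y and saturated for h: clearing denominators commutes with Y up to
the derivation, which lowers the exponent by one.  If u lies in it and q u = m,
the coordinate of (s h)^n u at m is the cofactor of q.  The auxiliary h lets an
application also invert operators such as x and Omega. *)
Lemma generic_freeness (m : M) (h : R) : h != 0 ->
  (forall r, r *: m = 0 -> r = 0) ->
  exists2 s : R, s != 0 & forall q u, q *: u = m ->
    (forall N : M -> Prop, submodule N -> (forall v, N v -> N (Y v)) ->
       (forall v, N (h *: v) -> N v) -> N m -> N u) ->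
    exists n r, s ^+ n = q * r.
Proof.
move=> h0 m_free; have [s [F [s0 FS Fm FY Fdiv]]] := free_sublattice m_free.
exists (s * h) => [|q u qu uN]; first by rewrite mulf_neq0.
have [n Fu] : exists n, F ((s * h) ^+ n *: u).
  apply: (uN (fun v => exists n, F ((s * h) ^+ n *: v))).
  - split.
    + by exists 0%N; rewrite scaler0; exact: submodule0.
    + move=> v w [n Fv] [n' Fw]; exists (n + n')%N; rewrite scalerDr.
      apply: submoduleD => //; last by rewrite exprD -scalerA; exact: submoduleZ.
      by rewrite addnC exprD -scalerA; exact: submoduleZ.
    + move=> a v [n Fv]; exists n; rewrite scalerA mulrC -scalerA.
      exact: submoduleZ.
  - move=> v [n Fv]; exists n.+2.
    (* One more factor lets s Y act inside F, the other one pays for the derivative. *)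
    have -> : (s * h) ^+ n.+2 *: Y v = h *: (s *: Y ((s * h) ^+ n.+1 *: v)) -
        (s * h * (delta (s * h) *+ n.+1)) *: ((s * h) ^+ n *: v).
      rewrite YZ delta_exp !scalerDr !scalerA [h * s]mulrC.
      rewrite [(s * h) ^+ n * _]mulrC [s * h * (_ * _)]mulrA addrK exprS.
      by congr (_ *: _); rewrite mulrCA mulrA.
    apply: submoduleD => //; last first.
      by apply: submoduleN => //; exact: submoduleZ.
    apply: submoduleZ => //; apply: FY; rewrite exprS -scalerA.
    exact: submoduleZ.
  - move=> v [n Fv]; exists n.+1.
    have -> : (s * h) ^+ n.+1 *: v = s *: ((s * h) ^+ n *: (h *: v)).
      by rewrite !scalerA exprSr mulrA [s * _ ^+ n]mulrC.
    exact: submoduleZ.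
  - by exists 0%N; rewrite scale1r.
exists n; apply: Fdiv Fu _; rewrite scalerA mulrC -scalerA qu //.
Qed.

Lemma exp_scale_Y p n v : p ^+ n.+1 *: Y v =
  Y (p ^+ n.+1 *: v) - (delta p *+ n.+1) *: (p ^+ n *: v).
Proof. by rewrite YZ delta_exp scalerA mulrC addrK. Qed.

(** Commuting p past Y replaces one factor p by its derivative, so n factors
survive fewer than n applications of Y. *)
Lemma exp_kills_iter p w n j : p *: w = 0 -> (j < n)%N ->
  p ^+ n *: iter j Y w = 0.
Proof.
move=> pw; elim: j n => [|j IH] [//|n] jn.
  by rewrite exprSr -scalerA pw scaler0.
by rewrite iterS exp_scale_Y !IH // 1?ltnW // raddf0 scaler0 subr0.
Qed.

(** The borderline case of [exp_kills_iter]: each application of Y must consume one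
factor p, and the n! orders in which this happens contribute equally. *)
Lemma exp_top_iter p w n : p *: w = 0 ->
  p ^+ n *: iter n Y w = (n`!)%:R *: ((- delta p) ^+ n *: w).
Proof.
move=> pw; elim: n => [|n IH]; first by rewrite fact0 !scale1r.
rewrite iterS exp_scale_Y exp_kills_iter // raddf0 sub0r IH -scaleNr !scalerA.
congr (_ *: _); rewrite factS natrM exprS -mulNrn -[- _ *+ _]mulr_natl.
by rewrite -!mulrA; congr (_ * _); rewrite mulrCA.
Qed.

End Freeness.

(** * Central operators on simple modules *)

Section CentralAction.
Variables (k : closedFieldType) (A : algType k) (M : lmodType A).
Implicit Types (a z : A) (u v : M) (p q : {poly k}).
Hypothesis simpleM : simple_mod M.

Definition central_on z := forall a u, a *: (z *: u) = z *: (a *: u).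

Definition scalar_on z := exists c : k, forall u, z *: u = c%:A *: u.

Lemma scalar_alg_central (c : k) : central_on c%:A.
Proof. by move=> a u; rewrite !scalerA mulr_algl mulr_algr. Qed.

Lemma scalar_alg_inj (c : k) u : c != 0 -> c%:A *: u = 0 -> u = 0.
Proof.
move=> c0 cu; rewrite -[u]scale1r -[1 : A]scale1r -(mulVf c0) -scalerA.
by rewrite -mulr_algl -scalerA cu scaler0.
Qed.

(** Schur: the kernel of a central operator is a submodule. *)
Lemma central_ker z : central_on z ->
  (forall u, z *: u = 0) \/ (forall u, z *: u = 0 -> u = 0).
Proof.
move=> zC; case: (pselect (exists2 u : M, z *: u = 0 & u != 0)) => [[m zm m0]|H].
  left=> u.
  apply: (@simple_submodule_full _ _ (fun v => z *: v = 0) m u simpleM) => //.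
  split=> [|v w zv zw|a v zv]; first by rewrite scaler0.
  - by rewrite scalerDr zv zw addr0.
  - by rewrite -zC zv scaler0.
by right=> u zu; apply/eqP/negPn/negP => u0; apply: H; exists u.
Qed.

Lemma central_surj z : central_on z -> (forall u, z *: u = 0 -> u = 0) ->
  forall u, exists v, z *: v = u.
Proof.
move=> zC zI u; have [[m m0] _] := simpleM.
apply: (@simple_submodule_full _ _ (fun u => exists v, z *: v = u) (z *: m) u
  simpleM).
- split=> [|v w [v' <-] [w' <-]|a v [v' <-]]; first by exists 0; rewrite scaler0.
  + by exists (v' + w'); rewrite scalerDr.
  + by exists (a *: v'); rewrite zC.
- by exists m.
- by apply: contraNneq m0 => /zI ->.
Qed.

Lemma central_subC z c : central_on z -> central_on (z - c%:A).
Proof.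
by move=> zC a u; rewrite !scalerBl scalerBr zC (scalar_alg_central c a u).
Qed.

(** As k is algebraically closed a polynomial in z is a product of factors z - c, and
each of them is injective unless it vanishes. *)
Lemma scalar_or_transcendental z : central_on z -> scalar_on z \/
  ((forall p, p != 0 -> forall u, horner_alg z p *: u = 0 -> u = 0) /\
   (forall c u, exists v, (z - c%:A) *: v = u)).
Proof.
move=> zC; have [[c zc]|noc] := pselect (exists c : k, forall u,
    (z - c%:A) *: u = 0).
  left; exists c => u; apply/eqP; rewrite -subr_eq0 -scalerBl; exact/eqP.
have inj c u : (z - c%:A) *: u = 0 -> u = 0.
  case: (central_ker (central_subC c zC)) => [H|]; last exact.
  by case: noc; exists c.
right; split=> [p p0 u|c u]; last first.
  exact: central_surj (central_subC c zC) (inj c) u.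
have [r pE] := closed_field_poly_normal p; rewrite pE linearZ /= -mulr_algl -scalerA.
have /scalar_alg_inj lc_inj : lead_coef p != 0 by rewrite lead_coef_eq0.
rewrite mulr1 => /lc_inj.
elim: {p p0 pE lc_inj} r u => [|c r IH] u.
  by rewrite big_nil rmorph1 scale1r.
rewrite big_cons rmorphM rmorphB /= horner_algX horner_algC -scalerA.
by move/inj/IH.
Qed.

Lemma nonroot_not_factor (s : {poly k}) : s != 0 ->
  exists c, forall n r, s ^+ n <> ('X - c%:P) * r.
Proof.
move=> /closed_nonrootP[c sc]; exists c => n r /(congr1 (horner^~ c)).
rewrite /= hornerM hornerXsubC subrr mul0r horner_exp => /eqP.
by rewrite expf_eq0 -rootE (negPf sc) andbF.
Qed.

(** [generic_freeness] over R = k[z], with the derivation zero: if z were not a scalar,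
m / (z - c) would exist for every c, and taking c outside the roots of s
contradicts the divisibility of s^n by 'X - c.  The premise on N asks only that
these quotients be generated from m by z, y and the inverse of h(z). *)
Lemma scalar_of_generation z y m (h : {poly k}) : central_on z ->
  (forall u, y *: (z *: u) = z *: (y *: u)) -> h != 0 -> m != 0 ->
  (forall c u, (z - c%:A) *: u = m -> forall N : M -> Prop, N m ->
    (forall v w, N v -> N w -> N (v + w)) -> (forall c v, N v -> N (c%:A *: v)) ->
    (forall v, N v -> N (z *: v)) -> (forall v, N v -> N (y *: v)) ->
    (forall v, N (horner_alg z h *: v) -> N v) -> N u) ->
  scalar_on z.
Proof.
move=> zC yz h0 m0 gen.
have [//|[inj surj]] := scalar_or_transcendental zC; exfalso.
pose f : {rmorphism {poly k} -> A} := horner_alg z.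
pose Y : {additive restrict f M -> restrict f M} := ( *:%R y : {additive M -> M}).
have YZ (r : {poly k}) (u : restrict f M) : Y (r *: u) = r *: Y u + 0 *: u.
  rewrite scale0r addr0; rewrite /Y /GRing.scale /= /restrict_scale /=.
  elim/poly_ind: r u => [|p c IH] u; first by rewrite rmorph0 !scale0r scaler0.
  rewrite rmorphD rmorphM /= horner_algX horner_algC !scalerDl scalerDr.
  congr (_ + _); last exact: scalar_alg_central.
  by rewrite -!scalerA IH yz.
have d0M (a b : {poly k}) : 0 = 0 * b + a * 0 by rewrite mul0r mulr0 addr0.
have m_free (r : {poly k}) : r *: (m : restrict f M) = 0 -> r = 0.
  move=> rm; apply/eqP/negPn/negP => r0; case/negP: m0; apply/eqP.
  exact: inj r0 _ rm.
have [s s0 H] := generic_freeness (delta := fun=> 0) d0M YZ h0 m_free.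
have [c nodiv] := nonroot_not_factor s0.
have [u qu] := surj c m.
have [] := H ('X - c%:P) u.
- apply: etrans qu; rewrite [LHS]/(f _ *: _); congr (_ *: _).
  by rewrite /f rmorphB /= horner_algX horner_algC.
- move=> N [N0 ND NZ] NY Nh Nm; apply: (gen c u qu N Nm ND) => //.
  + by move=> d v /(NZ d%:P); rewrite {1}/GRing.scale /= /restrict_scale /= horner_algC.
  + by move=> v /(NZ 'X); rewrite {1}/GRing.scale /= /restrict_scale /= horner_algX.
- by move=> n [r]; exact: nodiv.
Qed.

End CentralAction.

(** * Commutation rules in J *)

Section JordanRelations.
Variable k : fieldType.
Hypothesis two_neq0 : 2 != 0 :> k.
Local Notation x := (J_x k).
Local Notation y := (J_y k).
Local Notation g := (J_g k).
Local Notation g' := (J_ginv k).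
Local Notation Om := (Omega k).

Lemma gx_comm : g * x = x * g.
Proof.
by have [_ g'g gx _ _] := J_relations k; rewrite -{2}gx -mulrA g'g mulr1.
Qed.

Lemma ginvx_comm : g' * x = x * g'.
Proof.
have [gg' g'g _ _ _] := J_relations k.
by rewrite -[LHS]mulr1 -gg' mulrA -[_ * x * _]mulrA -gx_comm mulrA g'g mul1r.
Qed.

Lemma xy_swap : x * y = y * x + 2^-1 *: x ^+ 2.
Proof.
by have [_ _ _ _ yx] := J_relations k;
  rewrite -[2^-1 *: _]opprK -yx opprB addrCA subrr addr0.
Qed.

Lemma gy_swap : g * y = y * g + x * g.
Proof.
have [_ g'g _ gy _] := J_relations k.
by rewrite -mulrDl -gy -!mulrA g'g mulr1.
Qed.

Lemma ginvy_swap : g' * y = y * g' - x * g'.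
Proof.
have [_ g'g _ gy _] := J_relations k.
have := congr1 ( *%R g') gy; rewrite !mulrA g'g mul1r mulrDr ginvx_comm => ->.
by rewrite addrK.
Qed.

Lemma Omega_g : Om * g = x ^+ 2.
Proof. by have [_ g'g _ _ _] := J_relations k; rewrite /Omega -mulrA g'g mulr1. Qed.

Lemma xOmega_sqr_ginv : x * Om * (x * Om) * g' = Om ^+ 3.
Proof.
have C a := Omega_central a two_neq0.
have E : x ^+ 2 * g' = Om by [].
move: Om C E => O C E.
by rewrite {1}(C x) -!mulrA -(C g') exprS; congr (_ * _); rewrite !mulrA -expr2 E.
Qed.

Lemma horner_Omega_comm a p : a * horner_alg Om p = horner_alg Om p * a.
Proof.
elim/poly_ind: p => [|p c IH]; first by rewrite rmorph0 mulr0 mul0r.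
rewrite rmorphD rmorphM /= horner_algX horner_algC mulrDr mulrDl mulr_algl mulr_algr.
by rewrite -mulrA -(Omega_central a two_neq0) !mulrA IH.
Qed.

Definition eval_Omega_x_comm : commr_rmorph (horner_alg Om) x :=
  horner_Omega_comm x.

(** The image of k[Omega][x] in J: the inner variable is sent to Omega, the outer one
to x. *)
Definition eval_Omega_x : {rmorphism {poly {poly k}} -> jordan k} :=
  horner_morph eval_Omega_x_comm.

Lemma eval_Omega_xC p : eval_Omega_x p%:P = horner_alg Om p.
Proof. exact: horner_morphC. Qed.

Lemma eval_Omega_xX : eval_Omega_x 'X = x.
Proof. exact: horner_morphX. Qed.

(** The derivation [y, -] on k[Omega][x]; it sends x to - x^2 / 2 and kills Omega. *)
Definition y_derivation (p : {poly {poly k}}) : {poly {poly k}} :=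
  - (2^-1)%:P%:P * 'X^2 * p^`().

Lemma y_derivation_x :
  eval_Omega_x (- (2^-1)%:P%:P * 'X^2) = - (2^-1 *: x ^+ 2).
Proof.
rewrite mulNr rmorphN rmorphM rmorphXn; congr (- _).
by rewrite [X in X * _]eval_Omega_xC horner_algC mulr_algl [X in X ^+ _]eval_Omega_xX.
Qed.

Lemma y_derivationM p q :
  y_derivation (p * q) = y_derivation p * q + p * y_derivation q.
Proof.
rewrite /y_derivation; set c := _ * 'X^2.
by rewrite derivM mulrDr mulrA [p * (c * _)]mulrCA.
Qed.

(** Both sides are compatible with sums and products, so it is enough to look at x and
at polynomials in the central element Omega. *)
Lemma y_swap p : y * eval_Omega_x p =
  eval_Omega_x p * y + eval_Omega_x (y_derivation p).
Proof.
elim/poly_ind: p => [|p c IH].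
  by rewrite /y_derivation deriv0 mulr0 rmorph0 mulr0 mul0r addr0.
have -> : y_derivation (p * 'X + c%:P) =
    y_derivation p * 'X + p * (- (2^-1)%:P%:P * 'X^2).
  by rewrite /y_derivation derivD derivC addr0 -/(y_derivation _)
             [LHS]y_derivationM /y_derivation derivX mulr1.
have yx : y * x = x * y - 2^-1 *: x ^+ 2 by rewrite xy_swap addrK.
have D := rmorphD eval_Omega_x; have F := rmorphM eval_Omega_x.
rewrite !D (F p 'X) (F (y_derivation p)) (F p) y_derivation_x.
rewrite eval_Omega_xX eval_Omega_xC mulrDr mulrDl horner_Omega_comm.
rewrite mulrA IH mulrDl -[_ * y * x]mulrA yx mulrBr mulrA mulrN.
rewrite -!addrA; congr (_ + _).
by rewrite addrC -addrA [RHS]addrCA.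
Qed.

Lemma jordan_submodule (M : lmodType (jordan k)) (N : M -> Prop) : N 0 ->
  (forall u v, N u -> N v -> N (u + v)) -> (forall (c : k) u, N u -> N (c%:A *: u)) ->
  (forall u, N u -> N (g *: u)) -> (forall u, N u -> N (g' *: u)) ->
  (forall u, N u -> N (x *: u)) -> (forall u, N u -> N (y *: u)) -> submodule N.
Proof.
move=> N0 ND Nc Ng Ng' Nx Ny; split=> // a.
elim/jordan_ind: a => [c|||||a b Na Nb|a b Na Nb] u Nu; try by auto.
- by rewrite scalerDl; auto.
- by rewrite -scalerA; auto.
Qed.

End JordanRelations.

(** * Simple J-modules: Omega, or g and y, act by scalars *)

Section GeneratorActions.
Variable k : closedFieldType.
Hypothesis char0 : [pchar k] =i pred0.
Variable M : lmodType (jordan k).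
Hypothesis simpleM : simple_mod M.
Local Notation x := (J_x k).
Local Notation y := (J_y k).
Local Notation g := (J_g k).
Local Notation g' := (J_ginv k).
Local Notation Om := (Omega k).
Implicit Types (u v w m : M) (p : {poly {poly k}}).

Lemma natr_neq0 n : n.+1%:R != 0 :> k.
Proof. by move/pcharf0P: char0 => ->. Qed.

Lemma two_neq0 : 2 != 0 :> k. Proof. exact: (natr_neq0 1). Qed.

Lemma Omega_central_on : central_on M Om.
Proof. by move=> a u; rewrite !scalerA Omega_central ?two_neq0. Qed.

Lemma ginvK u : g *: (g' *: u) = u.
Proof. by have [gg' _ _ _ _] := J_relations k; rewrite scalerA gg' scale1r. Qed.

Lemma gK u : g' *: (g *: u) = u.
Proof. by have [_ g'g _ _ _] := J_relations k; rewrite scalerA g'g scale1r. Qed.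

(** The kernel of x is a submodule, because x can be moved to the right past every
generator. *)
Lemma x_zero_or_injective :
  (forall u, x *: u = 0) \/ (forall u, x *: u = 0 -> u = 0).
Proof.
case: (pselect (exists2 u : M, x *: u = 0 & u != 0)) => [[m xm m0]|H].
  left=> u.
  apply: (@simple_submodule_full _ _ (fun v => x *: v = 0) m u simpleM) => //.
  apply: jordan_submodule => [|v w xv xw|c v xv|v xv|v xv|v xv|v xv].
  - by rewrite scaler0.
  - by rewrite scalerDr xv xw addr0.
  - by rewrite scalerA mulr_algr -mulr_algl -scalerA xv scaler0.
  - by rewrite scalerA -gx_comm -scalerA xv scaler0.
  - by rewrite scalerA -ginvx_comm -scalerA xv scaler0.
  - by rewrite xv scaler0.
  - rewrite scalerA xy_swap scalerDl -mulr_algl expr2 -!scalerA.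
    by rewrite xv !scaler0 addr0.
by right=> u xu; apply/eqP/negPn/negP => u0; apply: H; exists u.
Qed.

End GeneratorActions.

Section SimpleJordanModules.
Variable k : closedFieldType.
Hypothesis char0 : [pchar k] =i pred0.
Variable M : lmodType (jordan k).
Hypothesis simpleM : simple_mod M.
Local Notation x := (J_x k).
Local Notation y := (J_y k).
Local Notation g := (J_g k).
Local Notation g' := (J_ginv k).
Local Notation Om := (Omega k).
Implicit Types (u v w m : M) (p q : {poly {poly k}}).
Let half_neq0 : 2^-1 != 0 :> k. Proof. by rewrite invr_eq0 two_neq0. Qed.

Lemma jordan_submodule_full (N : M -> Prop) m u : N m -> m != 0 ->
  (forall u v, N u -> N v -> N (u + v)) -> (forall (c : k) u, N u -> N (c%:A *: u)) ->
  (forall u, N u -> N (g *: u)) -> (forall u, N u -> N (g' *: u)) ->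
  (forall u, N u -> N (x *: u)) -> (forall u, N u -> N (y *: u)) -> N u.
Proof.
move=> Nm m0 ND Nc Ng Ng' Nx Ny.
apply: (@simple_submodule_full _ _ N m u simpleM) => //.
by apply: jordan_submodule => //; rewrite -(scale0r m) -(scale0r 1); exact: Nc.
Qed.

Lemma central_on_generators (z : jordan k) :
  (forall u, g *: (z *: u) = z *: (g *: u)) ->
  (forall u, g' *: (z *: u) = z *: (g' *: u)) ->
  (forall u, x *: (z *: u) = z *: (x *: u)) ->
  (forall u, y *: (z *: u) = z *: (y *: u)) -> central_on M z.
Proof.
move=> zg zg' zx zy a; elim/jordan_ind: a => [c|||||a b Ha Hb|a b Ha Hb] u //.
- by rewrite !scalerA mulr_algl mulr_algr.
- by rewrite !scalerDl Ha Hb scalerDr.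
- by rewrite -!scalerA Hb Ha.
Qed.

(** The Nullstellensatz for k[g^-1, g, y], in two steps.  First g is a scalar: over
k[g], powers of y and the inverse of g generate M from any nonzero vector.  Then M
is generated over k[y] alone, so y is a scalar too. *)
Lemma x_zero_scalars : (forall u, x *: u = 0) ->
  exists beta gamma : k, [/\ beta != 0, forall u, g *: u = beta%:A *: u &
    forall u, y *: u = gamma%:A *: u].
Proof.
move=> x0; have [[m m0] _] := simpleM.
have gyC u : g *: (y *: u) = y *: (g *: u).
  by rewrite scalerA gy_swap scalerDl -!scalerA x0 addr0.
have gC : central_on M g.
  by apply: central_on_generators => // u; rewrite ?x0 ?scaler0 // gK ginvK.
have [beta gE] : scalar_on M g.
  apply: (@scalar_of_generation _ _ _ simpleM g y m 'X) => //.
    by rewrite polyX_eq0.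
  move=> c u _ N Nm ND Nc Ng Ny Nh; apply: (jordan_submodule_full u Nm m0) => // v Nv.
  - by apply: Nh; rewrite horner_algX ginvK.
  - by rewrite x0 -(scale0r m) -(scale0r 1); exact: Nc.
have beta0 : beta != 0.
  apply: contraNneq m0 => beta0; rewrite -[m]gK gE beta0 scale0r scale0r.
  by rewrite scaler0.
have g'E u : g' *: u = beta^-1%:A *: u.
  rewrite -[in RHS](ginvK u) gE scalerA mulr_algl [beta^-1 *: _]scalerA mulVf //.
  by rewrite !scale1r.
have yC : central_on M y.
  apply: central_on_generators => // u; rewrite ?x0 ?scaler0 //.
  by rewrite !g'E scalar_alg_central.
have [gamma yE] : scalar_on M y.
  apply: (@scalar_of_generation _ _ _ simpleM y 0 m 1) => //.
    exact: oner_neq0.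
  move=> c u _ N Nm ND Nc Ny _ _; apply: (jordan_submodule_full u Nm m0) => // v Nv.
  - by rewrite gE; exact: Nc.
  - by rewrite g'E; exact: Nc.
  - by rewrite x0 -(scale0r m) -(scale0r 1); exact: Nc.
by exists beta, gamma.
Qed.

Section Injective.
Hypothesis x_inj : forall u, x *: u = 0 -> u = 0.

Lemma Omega_inj u : Om *: u = 0 -> u = 0.
Proof.
move=> Ou; rewrite -[u]ginvK; suff -> : g' *: u = 0 by rewrite scaler0.
by apply/x_inj/x_inj; rewrite scalerA -expr2 -Omega_g -scalerA ginvK.
Qed.

Section Transcendental.
Hypothesis Om_inj : forall q : {poly k}, q != 0 ->
  forall u, horner_alg Om q *: u = 0 -> u = 0.
Hypothesis Om_surj : forall (c : k) u, exists v, (Om - c%:A) *: v = u.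

Local Notation ev := (eval_Omega_x (two_neq0 char0)).
Local Notation M2 := (restrict ev M).
Let Y : {additive M2 -> M2} := ( *:%R y : {additive M -> M}).

Lemma ev_scaleE p u : p *: (u : M2) = ev p *: u. Proof. by []. Qed.

(** The hypothesis of generic freeness: on M, y is a first-order operator over
k[Omega][x]. *)
Lemma Y_scale p (u : M2) : Y (p *: u) = p *: Y u + y_derivation p *: u.
Proof.
apply: etrans (scalerA y (ev p) (u : M)) _; rewrite y_swap scalerDl -scalerA.
by [].
Qed.

(** If m had zero annihilator, [generic_freeness] would apply over k[Omega][x] with
h = x Omega: the inverse of h is what g = x^2 / Omega and its inverse require.
For the constants z - c, divisibility in k[Omega][x] is read off on the leading
coefficients in x. *)
Lemma exists_torsion : exists p m, [/\ p != 0, m != 0 & ev p *: m = 0].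
Proof.
apply: contrapT => no_torsion; have [[m m0] _] := simpleM.
have m_free p : p *: (m : M2) = 0 -> p = 0.
  move=> pm; apply/eqP/negPn/negP => p0; apply: no_torsion; exists p, m.
  by split.
have h0 : 'X * ('X)%:P != 0 :> {poly {poly k}}.
  by rewrite mulf_neq0 ?polyC_eq0 ?polyX_eq0.
have [s s0 H] := generic_freeness (@y_derivationM k) Y_scale h0 m_free.
have [|c nodiv] := @nonroot_not_factor k (lead_coef s).
  by rewrite lead_coef_eq0.
have [u qu] := Om_surj c m.
have [] := H ('X - c%:P)%:P u.
- apply: etrans qu; rewrite ev_scaleE eval_Omega_xC; congr (_ *: _).
  by rewrite rmorphB /= horner_algX horner_algC.
- move=> N [N0 ND NZ] NY Nh Nm; apply: (jordan_submodule_full u Nm m0) => //.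
  + by move=> d v /(NZ d%:P%:P); rewrite ev_scaleE eval_Omega_xC horner_algC.
  + move=> v Nv; apply: Nh; rewrite ev_scaleE rmorphM /= eval_Omega_xC eval_Omega_xX.
    (* x Omega g = x^3 *)
    rewrite horner_algX scalerA -mulrA Omega_g -exprS.
    by have := NZ 'X^3 v Nv; rewrite ev_scaleE rmorphXn /= eval_Omega_xX.
  + move=> v Nv; apply/Nh/Nh.
    (* (x Omega)^2 g^-1 = Omega^3 *)
    have hE w : ('X * ('X)%:P) *: (w : M2) = (x * Om) *: w.
      by rewrite ev_scaleE rmorphM /= eval_Omega_xC eval_Omega_xX horner_algX.
    rewrite !hE !scalerA xOmega_sqr_ginv ?two_neq0 //.
    have := NZ ('X^3)%:P v Nv.
    by rewrite ev_scaleE eval_Omega_xC rmorphXn /= horner_algX.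
  + by move=> v /(NZ 'X); rewrite ev_scaleE eval_Omega_xX.
move=> n [r E]; apply: (nodiv n (lead_coef r)).
by rewrite -lead_coef_exp E lead_coefM lead_coefC.
Qed.

(** The minimality ranges over all vectors, not only over m, so that polynomials of
smaller degree act injectively on all of M. *)
Lemma minimal_torsion : exists p m, [/\ p != 0, m != 0, ev p *: m = 0 &
  forall q v, q != 0 -> v != 0 -> ev q *: v = 0 -> (size p <= size q)%N].
Proof.
pose P n := `[< exists p m, [/\ p != 0, m != 0, ev p *: m = 0 & size p = n] >].
have exP : exists n, P n.
  have [p [m [p0 m0 pm]]] := exists_torsion.
  by exists (size p); apply/asboolP; exists p, m.
case: (ex_minnP exP) => n /asboolP[p [m [p0 m0 pm <-]]] minp.
exists p, m; split=> // q v q0 v0 qv; apply: minp; apply/asboolP.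
by exists q, v.
Qed.

Section MinimalTorsion.
Variables (p : {poly {poly k}}) (m : M).
Hypothesis p_neq0 : p != 0.
Hypothesis m_neq0 : m != 0.
Hypothesis pm : ev p *: m = 0.
Hypothesis minp : forall q v, q != 0 -> v != 0 -> ev q *: v = 0 ->
  (size p <= size q)%N.

Lemma ev_comm q q' u : ev q *: (ev q' *: u) = ev q' *: (ev q *: u).
Proof. by rewrite !scalerA -!rmorphM mulrC. Qed.

Lemma small_inj q u : q != 0 -> (size q < size p)%N -> ev q *: u = 0 -> u = 0.
Proof.
move=> q0 qp qu; apply/eqP/negPn/negP => u0.
by have := minp q0 u0 qu; rewrite leqNgt qp.
Qed.

(** A factor x of p could be cancelled, since x is injective. *)
Lemma coef0_neq0 : p`_0 != 0.
Proof.
apply/negP => /eqP p00.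
have pE : p = drop_poly 1 p * 'X.
  rewrite -{1}(poly_take_drop 1 p) expr1 [take_poly 1 p](_ : _ = 0) ?add0r //.
  by apply/polyP => -[|i]; rewrite coef_take_poly ?coef0.
have d0 : drop_poly 1 p != 0 by apply: contraNneq p_neq0 => d0; rewrite pE d0 mul0r.
move: pm m_neq0; rewrite pE rmorphM /= -scalerA eval_Omega_xX.
move/(small_inj d0) => H; rewrite (x_inj (H _)) ?eqxx //.
by rewrite size_drop_poly ltn_subrL size_poly_gt0 p_neq0.
Qed.

Lemma size_gt1 : (1 < size p)%N.
Proof.
rewrite ltnNge; apply/negP => /size1_polyC pE.
move: pm m_neq0; rewrite pE eval_Omega_xC => /Om_inj -> //; first by rewrite eqxx.
exact: coef0_neq0.
Qed.

(** The derivation of p is p' up to - x^2 / 2, and p' has smaller degree than p and is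
nonzero in characteristic zero. *)
Lemma y_derivation_inj u : ev p *: u = 0 -> ev (- y_derivation p) *: u = 0 -> u = 0.
Proof.
move=> pu; rewrite [X in X *: _](rmorphN ev) /y_derivation.
rewrite [X in - X](rmorphM ev) y_derivation_x mulNr opprK -mulr_algl expr2 -!scalerA.
move/(scalar_alg_inj half_neq0)/x_inj/x_inj; apply: small_inj.
- move: size_gt1; case E: (size p) => [|[|n]] // _.
  apply/eqP => /(congr1 (fun q : {poly {poly k}} => q`_n)) /eqP.
  rewrite coef_deriv coef0 -mulr_natr mulf_eq0 -(rmorph_nat polyC) polyC_eq0.
  rewrite (negPf (natr_neq0 _ _)) // orbF -[n.+1]/(n.+2.-1) -E -lead_coefE.
  by rewrite lead_coef_eq0 (negPf p_neq0).
- exact: lt_size_deriv.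
Qed.

(** Applying p^n to a sum of terms Y^j w_j with w_j in the kernel of p isolates the
term of index n, which becomes n! (- delta p)^n w_n; this operator is injective on
the kernel of p, so w_n = 0, and one descends. *)
Lemma y_independent n (w : nat -> M) u : (0 < n)%N -> (forall j, ev p *: w j = 0) ->
  ev p *: u = 0 -> u = \sum_(j < n) iter j Y (w j : M2) -> u = w 0%N.
Proof.
case: n => // n _ pw pu uE; elim: n uE => [|n IH]; first by rewrite big_ord1.
rewrite big_ord_recr /= => uE; suff w0 : w n.+1 = 0.
  apply: IH; rewrite uE w0; have -> : iter n Y 0 = 0.
    by elim: (n) => //= j ->; rewrite raddf0.
  by rewrite raddf0 addr0.
have := exp_top_iter (@y_derivationM k) Y_scale n.+1 (pw n.+1).
have -> : p ^+ n.+1 *: iter n.+1 Y (w n.+1) = 0.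
  have := congr1 ( *:%R (p ^+ n.+1) : M2 -> M2) uE.
  rewrite scalerDr scaler_sumr big1 ?add0r => [<-|i _].
    by rewrite exprSr -scalerA (pu : p *: (u : M2) = 0) scaler0.
  exact: (exp_kills_iter (@y_derivationM k) Y_scale (pw i) (ltn_ord i)).
move/esym; rewrite -[(_`!)%:R]/((_`!)%:R) -(rmorph_nat polyC) -(rmorph_nat polyC).
rewrite ev_scaleE eval_Omega_xC horner_algC => /scalar_alg_inj H.
have {}H : (- y_derivation p) ^+ n.+1 *: (w n.+1 : M2) = 0.
  by apply: H; have := fact_gt0 n.+1; case: (n.+1`!) => // f _; exact: natr_neq0.
move: (w n.+1) (pw n.+1) H => v pv.
elim: {uE IH}n.+1 => [|j IH]; first by rewrite scale1r.
rewrite exprS -scalerA => H; apply/IH/y_derivation_inj; last exact: H.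
by apply: etrans (ev_comm _ _ _) _; rewrite pv scaler0.
Qed.

Section YSums.
Variable W : M -> Prop.
Hypothesis W0 : W 0.
Hypothesis WD : forall u v, W u -> W v -> W (u + v).
Hypothesis Wc : forall (c : k) u, W u -> W (c%:A *: u).

Definition y_sums n u : Prop :=
  exists2 w : nat -> M, (forall j, W (w j)) & u = \sum_(j < n) iter j Y (w j : M2).

(** Horner form, which turns the closure properties below into inductions on n. *)
Lemma y_sumsS n u :
  y_sums n.+1 u <-> exists w v, [/\ W w, y_sums n v & u = w + y *: v].
Proof.
split=> [[w Ww ->]|[w [v [Ww [w' Ww' ->] ->]]]].
  exists (w 0%N), (\sum_(j < n) iter j Y (w j.+1 : M2)); split=> //.
    by exists (fun j => w j.+1).
  by rewrite big_ord_recl -[y *: _]/(Y _) raddf_sum.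
exists (fun j => if j is j'.+1 then w' j' else w); first by case.
by rewrite big_ord_recl -[y *: _]/(Y _) raddf_sum.
Qed.

Lemma y_sums0 n : y_sums n 0.
Proof.
exists (fun=> 0) => //; rewrite big1 // => j _.
by elim: (j : nat) => //= i ->; rewrite raddf0.
Qed.

Lemma y_sumsW n w : W w -> y_sums n.+1 w.
Proof.
move=> Ww; apply/y_sumsS; exists w, 0; split=> //; first exact: y_sums0.
by rewrite scaler0 addr0.
Qed.

Lemma y_sumsY n u : y_sums n u -> y_sums n.+1 (y *: u).
Proof. by move=> Fu; apply/y_sumsS; exists 0, u; rewrite add0r. Qed.

Lemma y_sumsD n u v : y_sums n u -> y_sums n v -> y_sums n (u + v).
Proof.
elim: n u v => [|n IH] u v.
  by move=> [w _ ->] [w' _ ->]; rewrite !big_ord0 addr0; exact: y_sums0.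
move=> /y_sumsS[w [u' [Ww Fu ->]]] /y_sumsS[w' [v' [Ww' Fv ->]]].
apply/y_sumsS; exists (w + w'), (u' + v'); split; [exact: WD|exact: IH|].
by rewrite scalerDr addrACA.
Qed.

Lemma y_sumsZ n (c : k) u : y_sums n u -> y_sums n (c%:A *: u).
Proof.
elim: n u => [|n IH] u.
  by move=> [w _ ->]; rewrite !big_ord0 scaler0; exact: y_sums0.
move=> /y_sumsS[w [v [Ww Fv ->]]]; rewrite scalerDr -scalar_alg_central.
by apply: y_sumsD; [exact/y_sumsW/Wc|exact/y_sumsY/IH].
Qed.

Lemma y_sums_lift n u : y_sums n u -> y_sums n.+1 u.
Proof.
elim: n u => [|n IH] u.
  by move=> [w _ ->]; rewrite big_ord0; exact: y_sums0.
move=> /y_sumsS[w [v [Ww Fv ->]]].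
by apply: y_sumsD; [exact: y_sumsW|exact/y_sumsY/IH].
Qed.

Hypothesis Wx : forall u, W u -> W (x *: u).
Hypothesis Wg : forall u, W u -> W (g *: u).
Hypothesis Wg' : forall u, W u -> W (g' *: u).

(** For b among x, g and its inverse, b y = y b + c x b with a constant c. *)
Lemma y_sums_commuting n u : y_sums n u ->
  [/\ y_sums n (x *: u), y_sums n (g *: u) & y_sums n (g' *: u)].
Proof.
elim: n u => [|n IH] u.
  by move=> [w _ ->]; rewrite !big_ord0 !scaler0; split; exact: y_sums0.
move=> /y_sumsS[w [v [Ww Fv ->]]]; have [Fx Fg Fg'] := IH _ Fv.
have [xx _ _] := IH _ Fx; have [xg _ _] := IH _ Fg; have [xg' _ _] := IH _ Fg'.
split; rewrite scalerDr; apply: y_sumsD; try by apply: y_sumsW; auto.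
- rewrite scalerA xy_swap scalerDl -mulr_algl expr2 -!scalerA.
  by apply: y_sumsD; [exact: y_sumsY|exact/y_sumsZ/y_sums_lift].
- rewrite scalerA gy_swap scalerDl -!scalerA.
  by apply: y_sumsD; [exact: y_sumsY|exact: y_sums_lift].
- rewrite scalerA ginvy_swap scalerBl -!scalerA.
  apply: y_sumsD; first exact: y_sumsY.
  by rewrite -scaleN1r -[-1]scaleN1r; exact/y_sumsZ/y_sums_lift.
Qed.

Lemma y_sums_full w u : W w -> w != 0 -> exists n, y_sums n.+1 u.
Proof.
move=> Ww w0; apply: (@jordan_submodule_full (fun u => exists n, y_sums n.+1 u) w u).
- by exists 0%N; exact: y_sumsW.
- by [].
- have pad j n v : y_sums n v -> y_sums (j + n) v.
    by elim: j => // j IH /IH/y_sums_lift.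
  move=> v v' [n Fv] [n' Fv']; exists (n' + n.+1)%N; apply: y_sumsD.
    exact: (pad n'.+1).
  have <- : (n.+1 + n'.+1 = (n' + n.+1).+1)%N by rewrite addnC.
  exact: pad.
- by move=> c v [n Fv]; exists n; exact: y_sumsZ.
- by move=> v [n /y_sums_commuting[_ Fv _]]; exists n.
- by move=> v [n /y_sums_commuting[_ _ Fv]]; exists n.
- by move=> v [n /y_sums_commuting[Fv _ _]]; exists n.
- by move=> v [n Fv]; exists n.+1; exact: y_sumsY.
Qed.

End YSums.

(** Let W be the part of N killed by p.  It is stable under x, Omega, g and g^-1: the
inverse of x is available on W because the relation p = 0 expresses p_0 / x as a
polynomial in x, and p_0 is inverted in N.  Hence the sums of y^j w_j with w_j in
W fill M, so u = m / (z - c) is such a sum; as u is itself killed by p,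
[y_independent] leaves only the term in W, which lies in N. *)
Lemma torsion_generation c u : (Om - c%:A) *: u = m -> forall N : M -> Prop, N m ->
    (forall v w, N v -> N w -> N (v + w)) -> (forall c v, N v -> N (c%:A *: v)) ->
    (forall v, N v -> N (Om *: v)) -> (forall v, N v -> N (x *: v)) ->
    (forall v, N (horner_alg Om ('X * p`_0) *: v) -> N v) -> N u.
Proof.
move=> qu N Nm ND Nc NO Nx Nh.
have N0 : N 0 by rewrite -(scale0r m) -(scale0r 1); exact: Nc.
have NhO (q : {poly k}) v : N v -> N (horner_alg Om q *: v).
  elim/poly_ind: q v => [|q d IH] v Nv; first by rewrite rmorph0 scale0r.
  rewrite rmorphD rmorphM /= horner_algX horner_algC scalerDl -scalerA.
  by auto.
have Nev q v : N v -> N (ev q *: v).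
  elim/poly_ind: q v => [|q d IH] v Nv; first by rewrite rmorph0 scale0r.
  rewrite rmorphD rmorphM /= eval_Omega_xX eval_Omega_xC scalerDl -scalerA.
  by auto.
have NOm v : N (Om *: v) -> N v.
  move=> NOv; apply: Nh; rewrite mulrC rmorphM /= horner_algX -scalerA.
  exact: NhO.
have Np0 v : N (horner_alg Om p`_0 *: v) -> N v.
  by move=> Npv; apply: Nh; rewrite rmorphM /= horner_algX -scalerA; exact: NO.
have Nxinv v : ev p *: v = 0 -> N (x *: v) -> N v.
  (* As p v = 0, p_0 v is minus a multiple of x v. *)
  move=> pv Nxv; apply: Np0.
  have pE : p = drop_poly 1 p * 'X + (p`_0)%:P.
    rewrite -{1}(poly_take_drop 1 p) expr1 addrC; congr (_ + _).
    by apply/polyP => -[|i]; rewrite coef_take_poly coefC.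
  move: pv; rewrite pE rmorphD rmorphM /= eval_Omega_xX eval_Omega_xC scalerDl.
  rewrite coefD coefMX coefC /= add0r -scalerA => /eqP.
  rewrite addrC addr_eq0 => /eqP ->.
  by rewrite -scaleN1r -[-1]scaleN1r; apply: Nc; exact: Nev.
pose W v := N v /\ ev p *: v = 0.
have evO v : ev p *: (Om *: v) = Om *: (ev p *: v) by exact: Omega_central_on.
have evx v : ev p *: (x *: v) = x *: (ev p *: v).
  by have := ev_comm p 'X v; rewrite eval_Omega_xX.
have OgE v : Om *: (g *: v) = x *: (x *: v).
  by rewrite scalerA Omega_g expr2 -scalerA.
have xxg'E v : x *: (x *: (g' *: v)) = Om *: v.
  by rewrite !scalerA -expr2.
have [n [w Ww uE]] : exists n, y_sums W n.+1 u.
  apply: (@y_sums_full W _ _ _ _ _ _ m) => //.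
  - by split=> //; rewrite scaler0.
  - by move=> v w [Nv pv] [Nw pw]; split; [exact: ND|rewrite scalerDr pv pw addr0].
  - move=> d v [Nv pv]; split; first exact: Nc.
    by rewrite scalar_alg_central pv scaler0.
  - by move=> v [Nv pv]; split; [exact: Nx|rewrite evx pv scaler0].
  - move=> v [Nv pv]; split; first by apply: NOm; rewrite OgE; exact/Nx/Nx.
    by apply: Omega_inj; rewrite -evO OgE !evx pv !scaler0.
  - move=> v [Nv pv]; have pg'v : ev p *: (g' *: v) = 0.
      by apply/x_inj/x_inj; rewrite -!evx xxg'E evO pv scaler0.
    split=> //; apply: (Nxinv _ pg'v); apply: Nxinv; first by rewrite evx pg'v scaler0.
    by rewrite xxg'E; exact: NO.
have pu : ev p *: u = 0.
  have : horner_alg Om ('X - c%:P) *: (ev p *: u) = 0.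
    rewrite scalerA -(horner_Omega_comm (two_neq0 char0)) -scalerA.
    by rewrite rmorphB /= horner_algX horner_algC qu pm.
  by apply: Om_inj; rewrite polyXsubC_eq0.
have -> : u = w 0%N.
  by apply: (@y_independent n.+1 w u) => // j; case: (Ww j).
by case: (Ww 0%N).
Qed.

End MinimalTorsion.

Lemma not_transcendental : scalar_on M Om.
Proof.
have [p [m [p0 m0 pm minp]]] := minimal_torsion.
apply: (@scalar_of_generation _ _ _ simpleM Om x m ('X * p`_0)) => //.
- exact: Omega_central_on.
- by move=> u; rewrite Omega_central_on.
- by rewrite mulf_neq0 ?polyX_eq0 //; exact: coef0_neq0 p0 m0 pm minp.
- exact: (@torsion_generation p m p0 m0 pm minp).
Qed.

End Transcendental.

(** The scalar is nonzero because Omega g = x^2 is injective. *)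
Lemma Omega_scalar : exists2 alpha : k, alpha != 0 & forall u, Om *: u = alpha%:A *: u.
Proof.
have [alpha aE] : scalar_on M Om.
  have [//|[inj surj]] :=
    scalar_or_transcendental simpleM (Omega_central_on char0 (M := M)).
  exact: not_transcendental inj surj.
exists alpha => //; have [[m m0] _] := simpleM.
by apply: contraNneq m0 => a0; apply/eqP/Omega_inj; rewrite aE a0 !scale0r.
Qed.

End Injective.
End SimpleJordanModules.

(** * Restriction of scalars and quotient algebras *)

Section Restriction.
Variables (A B : pzRingType) (f : {rmorphism A -> B}).

Lemma iso_restrict (M N : lmodType B) :
  iso_mod M N -> iso_mod (restrict f M) (restrict f N).
Proof.
move=> [h [h' hK h'K]]; apply: (@iso_mod_build A (restrict f M) (restrict f N) h).
- by move=> a u v; exact: (linearP h (f a) (u : M) (v : M)).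
- move=> u hu; apply: (can_inj hK); exact: etrans hu (esym (raddf0 h)).
- by move=> v; exists (h' v); exact: h'K.
Qed.

Lemma restrict_class_iso (M : lmodType B) :
  restrict_class f (iso_class M) = iso_class (restrict f M).
Proof.
apply/funext => N; apply/propext; split=> [[M' MM']|MN].
  by apply: iso_mod_trans; exact: iso_restrict.
by exists M => //; exact: iso_mod_refl.
Qed.

Hypothesis f_surj : forall b, exists a, f a = b.

Lemma restrict_simple (M : lmodType B) :
  simple_mod M <-> simple_mod (restrict f M).
Proof.
split=> sM; apply: simple_of_full; first by case: sM.
- move=> N m u [N0 ND NZ] Nm m0.
  apply: (@simple_submodule_full _ M N m u) => //; split=> // b v Nv.
  by have [a <-] := f_surj b; exact: NZ.
- by case: sM.
- move=> N m u [N0 ND NZ] Nm m0.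
  apply: (@simple_submodule_full _ (restrict f M) N m u) => //; split=> // a v.
  exact: NZ.
Qed.

Lemma iso_restrictE (M N : lmodType B) :
  iso_mod (restrict f M) (restrict f N) <-> iso_mod M N.
Proof.
split; last exact: iso_restrict.
move=> [h [h' hK h'K]]; apply: (@iso_mod_build B M N h).
- move=> b u v; have [a <-] := f_surj b.
  exact: (linearP h a (u : restrict f M) (v : restrict f M)).
- move=> u hu; apply: (can_inj hK); exact: etrans hu (esym (raddf0 h)).
- by move=> v; exists (h' v); exact: h'K.
Qed.

End Restriction.

Section QuotientModule.
Variables (A : pzRingType) (S : set A) (M : lmodType A).
Hypothesis S_kills : forall s, S s -> forall u : M, s *: u = 0.

Let ideal_kills a u : ideal_gen S a -> a *: (u : M) = 0.
Proof.
move=> Sa; elim: Sa u => {a} [a /S_kills //||a b _ Ha _ Hb|a b _ H|a b _ H] u.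
- by rewrite scale0r.
- by rewrite scalerDl Ha Hb addr0.
- by rewrite -scalerA H scaler0.
- by rewrite -scalerA H.
Qed.

Definition quot_module : Type := M.
HB.instance Definition _ := GRing.Zmodule.on quot_module.

Definition quot_module_scale (q : quot_alg S) (u : quot_module) : quot_module :=
  repr (q : Quotient.quot _) *: (u : M).

(** Two representatives of a class differ by an element of <S>, which kills M as soon as
S does. *)
Lemma quot_module_scaleE a u : quot_module_scale (quot_pi S a) u = a *: (u : M).
Proof.
apply/eqP; rewrite -subr_eq0 -scalerBl; apply/eqP/ideal_kills/ideal_predP/quot_piP.
exact: quot_reprK.
Qed.

Lemma quot_module_scaleA p q u :
  quot_module_scale p (quot_module_scale q u) = quot_module_scale (p * q) u.
Proof.
rewrite -[p]quot_reprK -[q]quot_reprK -(rmorphM (quot_pi S)).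
by rewrite !quot_module_scaleE [LHS]scalerA.
Qed.

Lemma quot_module_scale1 : left_id 1 quot_module_scale.
Proof. by move=> u; rewrite -(rmorph1 (quot_pi S)) quot_module_scaleE scale1r. Qed.

Lemma quot_module_scaleDr : right_distributive quot_module_scale +%R.
Proof. by move=> q u v; exact: scalerDr. Qed.

Lemma quot_module_scaleDl u : {morph quot_module_scale^~ u : p q / p + q}.
Proof.
move=> p q; rewrite -[p]quot_reprK -[q]quot_reprK -(raddfD (quot_pi S)).
by rewrite !quot_module_scaleE [LHS]scalerDl.
Qed.

HB.instance Definition _ := GRing.Zmodule_isLmodule.Build (quot_alg S) quot_module
  quot_module_scaleA quot_module_scale1 quot_module_scaleDr quot_module_scaleDl.

Lemma quot_module_restrict : iso_mod M (restrict (quot_pi S) quot_module).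
Proof.
apply: (@iso_mod_build _ M (restrict (quot_pi S) quot_module) id) => //.
  move=> a u v; congr (_ + _); exact: esym (quot_module_scaleE a u).
by move=> v; exists v.
Qed.

Lemma exists_quot_module :
  exists M' : lmodType (quot_alg S), iso_mod (restrict (quot_pi S) M') M.
Proof. by exists quot_module; exact/iso_mod_sym/quot_module_restrict. Qed.

End QuotientModule.

Lemma quot_pi_surj (A : pzRingType) (S : set A) (q : quot_alg S) :
  exists a, quot_pi S a = q.
Proof. by eexists; exact: quot_reprK. Qed.

Lemma quot_pi_rel (A : pzRingType) (S : set A) a : S a -> quot_pi S a = 0.
Proof.
move=> Sa; rewrite -(raddf0 (quot_pi S)).
by apply/quot_piP; rewrite subr0; apply/ideal_predP/ideal_gen_mem.
Qed.

(** * Finite-dimensional modules *)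

Section Dimension.
Variables (k : fieldType) (A : algType k).
Implicit Types M N : lmodType A.

Lemma has_dim1 M (m : M) : m != 0 -> (forall u, exists c : k, u = c%:A *: m) ->
  has_dim M 1.
Proof.
move=> m0 gen; apply: iso_mod_sym.
apply: (@iso_mod_build k 'rV[k]_1 (restrict (in_alg A) M)
          (fun v => (v 0 0)%:A *: m)).
- move=> c v w; rewrite !mxE !scalerDl; congr (_ + _).
  by apply/esym/(etrans (scalerA c%:A (v 0 0)%:A m)); rewrite mulr_algl scalerA.
- move=> v /eqP vm; apply/rowP => j; rewrite ord1 mxE.
  apply/eqP; apply: contraTT vm => v0; apply: contraNneq m0 => vm.
  rewrite -[m]scale1r -[1 : A]scale1r -(mulVf v0) -scalerA.
  by rewrite -mulr_algl -scalerA vm scaler0.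
- move=> u; have [c ->] := gen u; exists (c%:M).
  by rewrite mxE eqxx mulr1n.
Qed.

Lemma simple_of_dim1 M : has_dim M 1 -> simple_mod M.
Proof.
move=> [f [f' fK f'K]]; apply: simple_of_full.
  exists (f' 1%:M); apply: contra_neq (oner_neq0 k) => E.
  have := f'K 1%:M; rewrite E => /(congr1 (fun v : 'rV_1 => v 0 0)).
  by rewrite (raddf0 f) !mxE eqxx mulr1n.
move=> N m u [_ _ NZ] Nm m0.
have fm0 : f m 0 0 != 0.
  apply: contraNneq m0 => fm0; apply/eqP/(can_inj fK); rewrite (raddf0 f).
  by apply/rowP => j; rewrite ord1 fm0 mxE.
suff -> : u = (f u 0 0 / f m 0 0)%:A *: m by exact: NZ.
have fZ (c : k) (v : M) : f (c%:A *: v) = c *: f v by exact: (linearZ_LR f c v).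
apply: (can_inj fK); rewrite fZ.
by apply/rowP => j; rewrite ord1 mxE mulfVK.
Qed.

(** When both modules carry the same scalar action, any k-linear isomorphism is
A-linear. *)
Lemma iso_of_scalar_action M N n : has_dim M n -> has_dim N n ->
  (forall a, exists c : k, (forall u : M, a *: u = c%:A *: u) /\
                           (forall v : N, a *: v = c%:A *: v)) ->
  iso_mod M N.
Proof.
move=> dM dN scal; have [h [h' hK h'K]] := iso_mod_trans dM (iso_mod_sym dN).
apply: (@iso_mod_build A M N h).
- move=> a u v; have [c [cM cN]] := scal a.
  rewrite cM cN; exact: (linearP h c (u : restrict (in_alg A) M) v).
- move=> u hu; apply: (can_inj hK); exact: etrans hu (esym (raddf0 h)).
- by move=> v; exists (h' v); exact: h'K.
Qed.

Lemma has_dim_iso M N n : iso_mod M N -> has_dim M n -> has_dim N n.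
Proof.
by move=> MN; apply: iso_mod_trans; apply/iso_restrict/iso_mod_sym.
Qed.

Lemma dim0_eq0 M (u : M) : has_dim M 0 -> u = 0.
Proof.
by move=> [f [f' fK _]]; apply: (can_inj fK); rewrite thinmx0 [RHS]thinmx0.
Qed.

(** Row vectors are used, so that products are reversed. *)
Lemma matrix_of_action M n : has_dim M n -> exists rho : A -> 'M[k]_n,
  [/\ forall a b, rho (a - b) = rho a - rho b,
      forall a b, rho (a * b) = rho b *m rho a,
      forall c a, rho (c *: a) = c *: rho a &
      forall a c, (forall u : M, a *: u = c%:A *: u) -> rho a = c%:M].
Proof.
move=> [f [f' fK f'K]].
have fL (c : k) (u v : M) : f (c%:A *: u + v) = c *: f u + f v.
  exact: (linearP f c u v).
have f'L (c : k) v w : f' (c *: v + w) = c%:A *: (f' v : M) + f' w.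
  by apply: (can_inj fK); rewrite fL !f'K.
pose act a v := f (a *: (f' v : M)).
have actL a : linear (act a).
  move=> c v w; rewrite /act f'L scalerDr -fL; congr (f (_ + _)).
  by rewrite !scalerA mulr_algl mulr_algr.
pose actl a : {linear 'rV[k]_n -> 'rV[k]_n} :=
  HB.pack (act a) (GRing.isLinear.Build k _ _ _ (act a) (actL a)).
have rhoE a v : v *m lin1_mx (actl a) = f (a *: (f' v : M)) by exact: mul_rV_lin1.
have mxP (P Q : 'M[k]_n) : (forall v : 'rV_n, v *m P = v *m Q) -> P = Q.
  by move=> PQ; apply/row_matrixP => i; rewrite !rowE.
have fB (u v : M) : f (u - v) = f u - f v by exact: (raddfB f).
exists (fun a => lin1_mx (actl a)); split=> [a b|a b|c a|a c ac]; apply: mxP => v.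
- by rewrite mulmxBr !rhoE scalerBl fB.
- by rewrite mulmxA !rhoE fK scalerA.
- rewrite -scalemxAr !rhoE -mulr_algl -scalerA -[RHS]addr0 -[in RHS](raddf0 f).
  by rewrite -fL addr0.
- by rewrite rhoE ac mul_mx_scalar -[LHS](f'K) -[v in RHS]f'K -[RHS]addr0
     -(raddf0 f) -fL addr0 f'K.
Qed.

End Dimension.

(** * Classification *)

Section Classification.
Variable k : closedFieldType.
Hypothesis char0 : [pchar k] =i pred0.
Local Notation x := (J_x k).
Local Notation y := (J_y k).
Local Notation g := (J_g k).
Local Notation g' := (J_ginv k).
Local Notation Om := (Omega k).
Implicit Types (M N : lmodType (jordan k)) (alpha beta gamma : k).

Definition acts_by M beta gamma : Prop :=
  [/\ forall u : M, x *: u = 0, forall u : M, g *: u = beta%:A *: u &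
      forall u : M, y *: u = gamma%:A *: u].

(** Two modules with the same scalars on generators are treated at once, so that each
a acts on both by one and the same scalar, as [iso_of_scalar_action] needs. *)
Lemma acts_by_scalar M N beta gamma : beta != 0 ->
  acts_by M beta gamma -> acts_by N beta gamma ->
  forall a, exists c : k, (forall u : M, a *: u = c%:A *: u) /\
                          (forall v : N, a *: v = c%:A *: v).
Proof.
move=> beta0 [Mx Mg My] [Nx Ng Ny] a.
have ginvE (P : lmodType (jordan k)) : (forall u : P, g *: u = beta%:A *: u) ->
    forall u : P, g' *: u = beta^-1%:A *: u.
  move=> Pg u; rewrite -[in RHS](ginvK u) Pg scalerA mulr_algl.
  by rewrite [beta^-1 *: _]scalerA mulVf // !scale1r.
elim/jordan_ind: a => [c|||||a b [c [Mc Nc]] [d [Md Nd]]|a b [c [Mc Nc]] [d [Md Nd]]].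
- by exists c.
- by exists beta.
- by exists beta^-1; split; exact: ginvE.
- by exists 0; split=> u; rewrite !scale0r.
- by exists gamma.
- by exists (c + d); split=> u; rewrite !scalerDl ?Mc ?Nc ?Md ?Nd.
- have cdE (P : lmodType (jordan k)) (u : P) :
      c%:A *: (d%:A *: u) = (c * d)%:A *: u by rewrite scalerA mulr_algl scalerA.
  by exists (c * d); split=> u; rewrite -cdE -scalerA ?Md ?Nd ?Mc ?Nc.
Qed.

Lemma acts_by_gen_dim1 M beta gamma (m : M) : beta != 0 -> acts_by M beta gamma ->
  m != 0 -> (forall u, exists a, u = a *: m) -> has_dim M 1.
Proof.
move=> beta0 Mact m0 gen; apply: has_dim1 m0 _ => u; have [a ->] := gen u.
by have [c [cE _]] := acts_by_scalar beta0 Mact Mact a; exists c.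
Qed.

Lemma S_mod_acts_by beta gamma : acts_by (S_mod beta gamma) beta gamma.
Proof.
have rel a c : S_rel beta gamma (a - c%:A) ->
    forall u : S_mod beta gamma, a *: u = c%:A *: u.
  move=> Sa u; apply/eqP; rewrite -subr_eq0 -scalerBl; apply/eqP.
  have E := quot_pi_rel Sa.
  exact: etrans (congr1 (fun q => q * (u : quot_alg _)) E) (mul0r _).
split; [|apply: rel; rewrite /S_rel /=; by tauto..].
move=> u; have := rel x 0; rewrite scale0r subr0 => -> //.
  by rewrite scale0r.
by left; left.
Qed.

(** S_(beta, gamma) is spanned by the class of 1; that this class is nonzero is
witnessed by the character g |-> beta, x |-> 0, y |-> gamma of J. *)
Lemma S_mod_dim1 beta gamma : beta != 0 -> has_dim (S_mod beta gamma) 1.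
Proof.
move=> beta0.
apply: (@acts_by_gen_dim1 (S_mod beta gamma) beta gamma
          (1 : quot_alg (S_rel beta gamma))) => //.
- exact: S_mod_acts_by.
- have [chi [chi_g chi_g' chi_x chi_y]] : exists f : {lrmorphism jordan k -> k^o},
      [/\ f g = beta, f g' = beta^-1, f x = 0 & f y = gamma].
    apply: jordan_lift; rewrite ?mulfV ?mulVf ?mulr0 ?mul0r ?addr0 //.
      by rewrite mulrAC mulfV ?mul1r.
    by rewrite subrr expr0n scaler0 oppr0.
  have [|e eE] := @quot_lift _ (S_rel beta gamma) _ chi.
    have chi_scalar c : chi c%:A = c.
      by apply: etrans (linearZ_LR chi c 1) _; rewrite rmorph1; exact: mulr1.
    move=> s [[->|->]|->]; first exact: chi_x.
      apply: etrans (rmorphB chi g beta%:A) _; apply/eqP; rewrite subr_eq0.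
      by apply/eqP; exact: etrans chi_g (esym (chi_scalar beta)).
    apply: etrans (rmorphB chi y gamma%:A) _; apply/eqP; rewrite subr_eq0.
    by apply/eqP; exact: etrans chi_y (esym (chi_scalar gamma)).
  apply/eqP => one0; have /eqP := rmorph1 e; rewrite [X in e X]one0 rmorph0.
  by rewrite eq_sym oner_eq0.
- move=> u; exists (repr (u : Quotient.quot (ideal_pred (S_rel beta gamma)))).
  by apply/esym; apply: etrans (mulr1 _) _; exact: quot_reprK.
Qed.

Lemma acts_by_iso_S_mod M beta gamma : beta != 0 -> acts_by M beta gamma ->
  simple_mod M -> iso_mod M (S_mod beta gamma).
Proof.
move=> beta0 Mact sM; have [[m m0] _] := sM.
apply: (@iso_of_scalar_action _ _ _ _ 1%N).
- apply: (acts_by_gen_dim1 beta0 Mact m0) => u.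
  apply: (@simple_submodule_full _ M (fun u => exists a, u = a *: m) m u) => //.
    split=> [|_ _ [a ->] [b ->]|b _ [a ->]].
    - by exists 0; rewrite scale0r.
    - by exists (a + b); rewrite scalerDl.
    - by exists (b * a); rewrite scalerA.
  by exists 1; rewrite scale1r.
- exact: (S_mod_dim1 gamma beta0).
- exact: acts_by_scalar beta0 Mact (S_mod_acts_by beta gamma).
Qed.

(** From alpha = Omega = x^2 g^-1 the matrix X of x is invertible, and multiplying the
relation by X^-1 on both sides makes - 1/2 a commutator, of trace zero. *)
Lemma Omega_nonzero_infinite M alpha : (exists m : M, m != 0) -> alpha != 0 ->
  (forall u : M, Om *: u = alpha%:A *: u) -> ~ fin_dim M.
Proof.
move=> [m m0] alpha0 OmE [n dimM].
have [rho [rhoB rhoM rhoZ rho_scalar]] := matrix_of_action dimM.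
pose X := rho x; pose Y := rho y.
have XX : rho g' *m (X *m X) = alpha%:M.
  by rewrite -(rho_scalar _ _ OmE) -rhoM -rhoM.
have Xunit : X \in unitmx.
  have /mulmx1_unit[] : (alpha^-1 *: rho g' *m X) *m X = 1%:M.
    by rewrite -mulmxA -scalemxAl XX scale_scalar_mx mulVf.
  by [].
have XY : X *m Y - Y *m X = - (2^-1 *: (X *m X)).
  have [_ _ _ _ yx] := J_relations k.
  have rho0 : rho 0 = 0 by rewrite -(subrr 0) rhoB subrr.
  have rhoN a : rho (- a) = - rho a by rewrite -[- a]sub0r rhoB rho0 sub0r.
  by rewrite -!rhoM -rhoB yx rhoN rhoZ expr2.
have : \tr (Y *m invmx X - invmx X *m Y) = - (2^-1 * n%:R).
  have -> : Y *m invmx X - invmx X *m Y = - (2^-1 *: 1%:M).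
    transitivity (invmx X *m (X *m Y - Y *m X) *m invmx X).
      by rewrite mulmxBr mulmxBl !mulmxA mulVmx // mul1mx -mulmxA mulmxV // mulmx1.
    rewrite XY mulmxN mulNmx -scalemxAr -scalemxAl mulmxA mulVmx // mul1mx.
    by rewrite mulmxV.
  by rewrite raddfN /= mxtraceZ mxtrace1.
rewrite raddfB /= mxtrace_mulC subrr => /esym/eqP.
rewrite oppr_eq0 mulf_eq0 invr_eq0 (negPf (two_neq0 char0)) /=.
case: n dimM {rho rhoB rhoM rhoZ rho_scalar X Y XX Xunit XY} => [dimM _|n _].
  by case/eqP: m0; exact: dim0_eq0 dimM.
by rewrite (negPf (natr_neq0 char0 n)).
Qed.

Lemma simple_jordan_cases M : simple_mod M ->
  (exists beta gamma, beta != 0 /\ acts_by M beta gamma) \/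
  (exists2 alpha, alpha != 0 & forall u : M, Om *: u = alpha%:A *: u).
Proof.
move=> sM; have [x0|xI] := x_zero_or_injective sM; [left|right].
  have [beta [gamma [beta0 gE yE]]] := x_zero_scalars sM x0.
  by exists beta, gamma.
exact: Omega_scalar.
Qed.

Lemma simple_fin_dim_acts_by M : simple_mod M -> fin_dim M ->
  exists beta gamma, beta != 0 /\ acts_by M beta gamma.
Proof.
move=> sM fM; have [//|[alpha a0 aE]] := simple_jordan_cases sM.
by case: (Omega_nonzero_infinite _ a0 aE fM); case: sM.
Qed.

Lemma simple_fin_dim_iso M : simple_mod M -> fin_dim M ->
  exists beta gamma, beta != 0 /\ iso_mod M (S_mod beta gamma).
Proof.
move=> sM fM; have [beta [gamma [b0 act]]] := simple_fin_dim_acts_by sM fM.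
by exists beta, gamma; split=> //; exact: acts_by_iso_S_mod.
Qed.

Lemma simple_fin_dim_dim1 M : simple_mod M -> fin_dim M -> has_dim M 1.
Proof.
move=> sM fM; have [beta [gamma [b0 isoS]]] := simple_fin_dim_iso sM fM.
exact: has_dim_iso (iso_mod_sym isoS) (S_mod_dim1 gamma b0).
Qed.

Lemma iso_scalar M N (a : jordan k) (c d : k) : iso_mod M N ->
  (exists m : M, m != 0) -> (forall u : M, a *: u = c%:A *: u) ->
  (forall v : N, a *: v = d%:A *: v) -> c = d.
Proof.
move=> [f [f' fK _]] [m m0] aM aN; apply/eqP; rewrite -subr_eq0.
apply: contraNT m0 => cd0; apply/eqP/(can_inj fK); rewrite raddf0.
have fZ b : f (b *: m) = b *: f m by exact: linearZ.
by apply: (scalar_alg_inj cd0); rewrite !scalerBl -fZ -aM fZ aN subrr.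
Qed.

Lemma infinite_iff_Omega M : simple_mod M ->
  (~ fin_dim M <-> exists2 alpha, alpha != 0 & forall m : M, Om *: m = alpha%:A *: m).
Proof.
move=> sM; split=> [infM|[alpha a0 aE]]; last first.
  by apply: Omega_nonzero_infinite a0 aE; case: sM.
have [[beta [gamma [b0 act]]]|//] := simple_jordan_cases sM.
case: infM; exists 1%N.
exact: has_dim_iso (iso_mod_sym (acts_by_iso_S_mod b0 act sM)) (S_mod_dim1 gamma b0).
Qed.

Lemma Jalpha_Omega alpha (M : lmodType (Jalpha alpha))
  (u : restrict (Jalpha_pi alpha) M) :
  Om *: u = alpha%:A *: u.
Proof.
apply/eqP; rewrite -subr_eq0 -scalerBl; apply/eqP.
have E : Jalpha_pi alpha (Om - alpha%:A) = 0.
  by apply: quot_pi_rel; exists 1 => //; rewrite mulr1.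
exact: etrans (congr1 (fun q => q *: (u : M)) E) (scale0r _).
Qed.

Lemma Jalpha_pi_surj alpha (q : Jalpha alpha) : exists a, Jalpha_pi alpha a = q.
Proof. exact: quot_pi_surj. Qed.

Lemma Jalpha_module M alpha : (forall u : M, Om *: u = alpha%:A *: u) ->
  exists M' : lmodType (Jalpha alpha), iso_mod (restrict (Jalpha_pi alpha) M') M.
Proof.
move=> OmE; apply: (@exists_quot_module _ (Jalpha_rel alpha) M).
by move=> s [a _ <-] u; rewrite -scalerA scalerBl OmE subrr.
Qed.

End Classification.

Theorem corollary3p3 (k : closedFieldType) (char0 : [pchar k] =i pred0) :
  ((forall C : mod_class (jordan k),
      hat_fin C <->
      exists beta gamma : k, beta != 0 /\ C = iso_class (S_mod beta gamma)) /\
   (forall beta gamma beta' gamma' : k, beta != 0 -> beta' != 0 ->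
      iso_mod (S_mod beta gamma) (S_mod beta' gamma') ->
      beta = beta' /\ gamma = gamma') /\
   (forall M : lmodType (jordan k), simple_mod M -> fin_dim M -> has_dim M 1)) /\
  ((forall M : lmodType (jordan k), simple_mod M ->
      (~ fin_dim M <->
       exists2 alpha : k, alpha != 0 &
         forall m : M, Omega k *: m = alpha%:A *: m)) /\
   (forall C : mod_class (jordan k),
      hat_inf C <->
      exists2 alpha : k, alpha != 0 &
        exists2 D : mod_class (Jalpha alpha), hat D &
          C = restrict_class (Jalpha_pi alpha) D) /\
   (forall (alpha : k) (D D' : mod_class (Jalpha alpha)),
      alpha != 0 -> hat D -> hat D' ->
      restrict_class (Jalpha_pi alpha) D = restrict_class (Jalpha_pi alpha) D' ->
      D = D') /\
   (forall (alpha alpha' : k) (D : mod_class (Jalpha alpha))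
      (D' : mod_class (Jalpha alpha')),
      alpha != 0 -> alpha' != 0 -> hat D -> hat D' ->
      restrict_class (Jalpha_pi alpha) D = restrict_class (Jalpha_pi alpha') D' ->
      alpha = alpha')).
Proof.
have S_dim1 := @S_mod_dim1 k.
split; [split; [|split]|split; [|split; [|split]]].
- move=> C; split=> [[M [sM fM ->]]|[beta [gamma [b0 ->]]]].
    have [beta [gamma [b0 isoS]]] := simple_fin_dim_iso char0 sM fM.
    by exists beta, gamma; split=> //; apply/iso_class_eq.
  exists (S_mod beta gamma); split=> //; last by exists 1%N; exact: S_dim1.
  exact/simple_of_dim1/S_dim1.
- move=> beta gamma beta' gamma' b0 b0' isoS.
  have [nz _] := simple_of_dim1 (S_dim1 beta gamma b0).
  have [_ g1 y1] := S_mod_acts_by beta gamma.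
  have [_ g2 y2] := S_mod_acts_by beta' gamma'.
  by split; [exact: iso_scalar isoS nz g1 g2|exact: iso_scalar isoS nz y1 y2].
- exact: simple_fin_dim_dim1.
- exact: infinite_iff_Omega.
- move=> C; split=> [[M [sM infM ->]]|[alpha a0 [D [M [sM ->]] ->]]].
    have [alpha a0 aE] := (infinite_iff_Omega char0 sM).1 infM.
    have [M' M'M] := Jalpha_module aE.
    exists alpha => //; exists (iso_class M').
      exists M'; split=> //; apply/(restrict_simple (@Jalpha_pi_surj k alpha)).
      exact: simple_iso (iso_mod_sym M'M) sM.
    by rewrite restrict_class_iso; apply/iso_class_eq/iso_mod_sym.
  have sR : simple_mod (restrict (Jalpha_pi alpha) M).
    exact/(restrict_simple (@Jalpha_pi_surj k alpha)).
  exists (restrict (Jalpha_pi alpha) M); split=> //.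
    apply/(infinite_iff_Omega char0 sR); exists alpha => // u.
    exact: Jalpha_Omega.
  exact: restrict_class_iso.
- move=> alpha _ _ a0 [M [sM ->]] [M' [sM' ->]].
  rewrite !restrict_class_iso => /iso_class_eq isoR; apply/iso_class_eq.
  exact/(iso_restrictE (@Jalpha_pi_surj k alpha)).
- move=> alpha alpha' _ _ a0 a0' [M [sM ->]] [M' [sM' ->]].
  rewrite !restrict_class_iso => /iso_class_eq isoR.
  apply: (iso_scalar isoR (a := Omega k)) => [|u|u]; first by case: sM.
  - exact: Jalpha_Omega.
  - exact: Jalpha_Omega.
Qed.
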